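(* Let $Y\in\mathbb{C}^{(n\times n)\cdot d}$, let $(A,b,c)_Y$ be a realization about $Y$ on the Hilbert space $\mathcal{H}$ with quantized transfer function $f$, let $\mathscr{M}_{A,b,c}=\mathscr{C}_{A,c}\ominus(\mathscr{C}_{A,c}\cap\mathscr{O}_{A^\dagger,b}^\perp)$ be its minimal subspace and $Q_0$ the orthogonal projection of $\mathcal{H}$ onto $\mathscr{M}_{A,b,c}$. Define $A^{(0)}_j(G)=Q_0A_j(G)|_{\mathscr{M}_{A,b,c}}$ for $G\in\mathbb{C}^{n\times n}$, $1\le j\le d$, $b_0=Q_0b$ and $c_0=Q_0c$. Then $(A^{(0)},b_0,c_0)_Y$ is a minimal realization about $Y$, it is analytically equivalent at $Y$ to $(A,b,c)_Y$, and the two realizations define the same quantized transfer function $f$ on $\mathscr{D}^{\leadsto Y}(A)\cap\mathscr{D}^{\leadsto Y}(A^{(0)})$.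
   Context: Fix $d\in\mathbb{N}$. $\mathbb{C}^{(k\times k)\cdot d}$ denotes column $d$-tuples of complex $k\times k$ matrices with $\|X\|_{\mathrm{col}}$ the operator norm of the stacked $kd\times k$ matrix; the uniform topology is generated by the sets $\bigsqcup_m\{X\in\mathbb{C}^{(mk\times mk)\cdot d}:\|X-I_m\otimes Z\|_{\mathrm{col}}<r\}$. A realization about $Y\in\mathbb{C}^{(n\times n)\cdot d}$, $(A,b,c)_Y$, consists of a Hilbert space $\mathcal{H}$, linear maps $A_1,\dots,A_d:\mathbb{C}^{n\times n}\to\mathscr{B}(\mathcal{H})$ and $b,c\in\mathscr{B}(\mathbb{C}^n,\mathcal{H})$. For $X\in\mathbb{C}^{(mn\times mn)\cdot d}$ (viewed as $m\times m$ block matrices with $n\times n$ blocks, $\mathrm{id}_m\otimes A_j$ acting blockwise on $\mathbb{C}^m\otimes\mathcal{H}$), $L_A(X)=I_m\otimes I_{\mathcal{H}}-\sum_j(\mathrm{id}_m\otimes A_j)(X_j)$; $\mathscr{D}^Y_m(A)=\{X\in\mathbb{C}^{(mn\times mn)\cdot d}:L_A(X-I_m\otimes Y)\text{ invertible}\}$, $\mathscr{D}^Y(A)=\bigsqcup_m\mathscr{D}^Y_m(A)$, and $\mathscr{D}^{\leadsto Y}(A)=\bigsqcup_m\mathscr{D}^{\leadsto Y}_m(A)$ where $\mathscr{D}^{\leadsto Y}_m(A)$ is the path-connected component of $\mathscr{D}^Y_m(A)$ containing $I_m\otimes Y$. The quantized transfer function is $f(X)=(I_m\otimes b^* )L_A(X-I_m\otimes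 Y)^{-1}(I_m\otimes c)$ on $\mathscr{D}^Y_m(A)$. Two realizations about $Y$ are analytically equivalent at $Y$ if their quantized transfer functions agree on a uniformly open neighbourhood of $Y$. For a word $\omega=i_1\cdots i_\ell\in\mathbb{F}^+_d$, $A^\omega(G_1,\dots,G_\ell)=A_{i_1}(G_1)\cdots A_{i_\ell}(G_\ell)$ and $A^{\omega;\dagger}(G_1,\dots,G_\ell)=A_{i_\ell}(G_\ell^* )^*\cdots A_{i_1}(G_1^* )^*$. The controllable subspace $\mathscr{C}_{A,c}$ is the closed linear span of all $A^\omega(\vec G)c(v)$ and the observable subspace $\mathscr{O}_{A^\dagger,b}$ the closed linear span of all $A^{\omega;\dagger}(\vec G)b(u)$ ($\omega\in\mathbb{F}^+_d$, $G_i\in\mathbb{C}^{n\times n}$, $u,v\in\mathbb{C}^n$). A realization is minimal if both subspaces equal the whole Hilbert space. *)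

(* Defs.v *)
From HB Require Import structures.
From mathcomp Require Import all_boot all_order all_algebra.
From mathcomp Require Import complex mxtens.
From mathcomp Require Import boolp classical_sets reals.
From Stdlib Require Import ClassicalEpsilon.

Set Implicit Arguments.
Unset Strict Implicit.
Unset Printing Implicit Defensive.

Import Order.TTheory GRing.Theory Num.Theory.
Local Open Scope ring_scope.
Local Open Scope classical_set_scope.

Definition cnorm {R : realType} (z : R[i]) : R := ComplexField.Normc.normc z.

Definition adjmx {R : realType} {n : nat} (G : 'M[R[i]]_n) : 'M[R[i]]_n :=
  (map_mx (@conjc R) G)^T.

Section Hilbert.
Context {R : realType} {H : lmodType R[i]} (ip : H -> H -> R[i]).

Definition hnorm (x : H) : R := Num.sqrt (complex.Re (ip x x)).

Record is_hilbert : Prop := IsHilbert {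
  ip_linear_l : forall (a : R[i]) (x y z : H), ip (a *: x + y) z = a * ip x z + ip y z;
  ip_conj : forall x y : H, ip y x = conjc (ip x y);
  ip_pos : forall x : H, 0 <= complex.Re (ip x x);
  ip_def : forall x : H, ip x x = 0 -> x = 0;
  ip_complete : forall u : nat -> H,
    (forall e : R, 0 < e -> exists N, forall p q, (N <= p)%N -> (N <= q)%N ->
        hnorm (u p - u q) < e) ->
    exists l : H, forall e : R, 0 < e -> exists N, forall p, (N <= p)%N ->
        hnorm (u p - l) < e }.

Definition closed_span (G : set H) : set H :=
  [set x | forall e : R, 0 < e -> exists k (a : 'I_k -> R[i]) (g : 'I_k -> H),
      (forall i, G (g i)) /\ hnorm (x - \sum_(i < k) a i *: g i) < e].

Definition perp (G : set H) : set H := [set x | forall y, G y -> ip x y = 0].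

Definition closed_subspace (S : set H) : Prop :=
  [/\ S 0,
      (forall (a : R[i]) x y, S x -> S y -> S (a *: x + y)) &
      (forall x, (forall e : R, 0 < e -> exists y, S y /\ hnorm (x - y) < e) -> S x)].

Definition orthproj (M : set H) (x : H) : H :=
  epsilon (inhabits 0) (fun z => M z /\ perp M (x - z)).

(* Operators on a Hilbert space S, where S is a closed subspace of H        *)
(* (the ambient H itself being the case S = setT).  An operator of B(S) is  *)
(* represented by a function H -> H, only its values on S being relevant.   *)
Definition maps_into (S : set H) (T : H -> H) := forall x, S x -> S (T x).
Definition linear_on (S : set H) (T : H -> H) :=
  forall (a : R[i]) x y, S x -> S y -> T (a *: x + y) = a *: T x + T y.
Definition bounded_on (S : set H) (T : H -> H) :=
  exists K : R, forall x, S x -> hnorm (T x) <= K * hnorm x.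

Definition adj (S : set H) (T : H -> H) (y : H) : H :=
  epsilon (inhabits 0) (fun z => S z /\ forall x, S x -> ip (T x) y = ip x z).

Section Realization.
Context {d n : nat}.
Implicit Types (S : set H) (A : 'I_d -> 'M[R[i]]_n -> H -> H) (b c : 'cV[R[i]]_n -> H).

Definition is_realization S A b c : Prop :=
  [/\ closed_subspace S,
      (forall j G, [/\ maps_into S (A j G), linear_on S (A j G) & bounded_on S (A j G)]),
      (forall j (a : R[i]) G G' x, S x -> A j (a *: G + G') x = a *: A j G x + A j G' x),
      (forall v, S (b v) /\ S (c v)) &
      (forall (a : R[i]) v w, b (a *: v + w) = a *: b v + b w /\
                              c (a *: v + w) = a *: c v + c w)].

Definition apply_word A (w : seq ('I_d * 'M[R[i]]_n)) (x : H) : H :=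
  foldr (fun p y => A p.1 p.2 y) x w.

Definition apply_word_dag S A (w : seq ('I_d * 'M[R[i]]_n)) (x : H) : H :=
  foldl (fun y p => adj S (A p.1 (adjmx p.2)) y) x w.

Definition ctrl_space A c : set H :=
  closed_span [set x | exists w v, x = apply_word A w (c v)].

Definition obs_space S A b : set H :=
  closed_span [set x | exists w u, x = apply_word_dag S A w (b u)].

Definition minimal_realization S A b c : Prop :=
  is_realization S A b c /\ ctrl_space A c = S /\ obs_space S A b = S.

Definition minimal_subspace A b c : set H :=
  ctrl_space A c `&` perp (ctrl_space A c `&` perp (obs_space setT A b)).

Section Level.
Context {m : nat}.

(* block (i,k) of an mn x mn matrix; index (i,p) <-> i*n + p, matching *t *)
Definition blk (X : 'M[R[i]]_(m * n)) (i k : 'I_m) : 'M[R[i]]_n :=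
  \matrix_(p, q) X (mxtens_index (i, p)) (mxtens_index (k, q)).

(* vectors of C^m (x) S *)
Definition in_Sm S (v : 'I_m -> H) := forall i, S (v i).
Definition hnormm (v : 'I_m -> H) : R := Num.sqrt (\sum_i hnorm (v i) ^+ 2).

(* L_A(X) = I_m (x) I - sum_j (id_m (x) A_j)(X_j) acting on C^m (x) H *)
Definition LA A (X : 'I_d -> 'M[R[i]]_(m * n)) (v : 'I_m -> H) : 'I_m -> H :=
  fun i => v i - \sum_(j < d) \sum_(k < m) A j (blk (X j) i k) (v k).

Definition is_inverse_on S (L T : ('I_m -> H) -> ('I_m -> H)) : Prop :=
  [/\ forall v, in_Sm S v -> in_Sm S (T v),
      forall (a : R[i]) v w, in_Sm S v -> in_Sm S w ->
          T (fun i => a *: v i + w i) = (fun i => a *: T v i + T w i),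
      exists K : R, forall v, in_Sm S v -> hnormm (T v) <= K * hnormm v
    & forall v, in_Sm S v -> T (L v) = v /\ L (T v) = v].

Definition invertible_on S L := exists T, is_inverse_on S L T.

Definition inv_on S (L : ('I_m -> H) -> ('I_m -> H)) : ('I_m -> H) -> ('I_m -> H) :=
  epsilon (inhabits id) (fun T => is_inverse_on S L T).

Definition ampl (Y : 'I_d -> 'M[R[i]]_n) : 'I_d -> 'M[R[i]]_(m * n) :=
  fun j => (1%:M : 'M[R[i]]_m) *t Y j.

Definition shiftY (Y : 'I_d -> 'M[R[i]]_n) (X : 'I_d -> 'M[R[i]]_(m * n)) :=
  fun j => X j - ampl Y j.

Definition in_dom S A Y (X : 'I_d -> 'M[R[i]]_(m * n)) : Prop :=
  invertible_on S (LA A (shiftY Y X)).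

(* quantized transfer function f(X) = (I_m (x) b^* ) L_A(X - I_m (x) Y)^{-1} (I_m (x) c) *)
Definition transfer S A b c Y (X : 'I_d -> 'M[R[i]]_(m * n)) : 'M[R[i]]_(m * n) :=
  \matrix_(r, s)
    let ip1 := mxtens_unindex r in let ks := mxtens_unindex s in
    ip (inv_on S (LA A (shiftY Y X))
          (fun i' => if i' == ks.1 then c (delta_mx ks.2 ord0) else 0) ip1.1)
       (b (delta_mx ip1.2 ord0)).

End Level.

End Realization.
End Hilbert.

Section Uniform.
Context {R : realType} {d : nat}.

Definition vnorm2 {k} (v : 'cV[R[i]]_k) : R := \sum_i cnorm (v i ord0) ^+ 2.

(* ||X||_col : operator norm of the stacked kd x k matrix *)
Definition colnorm {k} (X : 'I_d -> 'M[R[i]]_k) : R :=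
  sup [set Num.sqrt (\sum_(j < d) vnorm2 (X j *m v)) | v in [set v | vnorm2 v = 1]].

Definition ncpt := {k : nat & 'I_d -> 'M[R[i]]_k}.

Definition gen_set (k : nat) (Z : 'I_d -> 'M[R[i]]_k) (r : R) : set ncpt :=
  [set p | exists m (X : 'I_d -> 'M[R[i]]_(m * k)),
      p = existT _ (m * k) X /\ colnorm (fun j => X j - (1%:M : 'M[R[i]]_m) *t Z j) < r].

Definition gen_inter (s : seq {k : nat & (('I_d -> 'M[R[i]]_k) * R)%type}) : set ncpt :=
  foldr (fun g acc => gen_set (projT2 g).1 (projT2 g).2 `&` acc) setT s.

Definition unif_open (U : set ncpt) : Prop :=
  forall p, U p -> exists s, gen_inter s p /\ gen_inter s `<=` U.

End Uniform.

(* path component of D^Y_m(A) containing I_m (x) Y (level m carries the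
   topology induced by ||.||_col, i.e. the uniform topology restricted to it) *)
Definition in_dom_path {R : realType} {H : lmodType R[i]} (ip : H -> H -> R[i])
    {d n : nat} (S : set H) (A : 'I_d -> 'M[R[i]]_n -> H -> H)
    (Y : 'I_d -> 'M[R[i]]_n) (m : nat) (X : 'I_d -> 'M[R[i]]_(m * n)) : Prop :=
  exists gam : R -> ('I_d -> 'M[R[i]]_(m * n)),
    [/\ gam 0 = ampl Y, gam 1 = X,
        (forall t, 0 <= t <= 1 -> in_dom ip S A Y (gam t)) &
        (forall t, 0 <= t <= 1 -> forall e : R, 0 < e -> exists2 del : R, 0 < del &
           forall s, 0 <= s <= 1 -> `|s - t| < del ->
             colnorm (fun j => gam s j - gam t j) < e)].

Definition analytically_equiv {R : realType} {H : lmodType R[i]} (ip : H -> H -> R[i])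
    {d n : nat} (S1 : set H) (A1 : 'I_d -> 'M[R[i]]_n -> H -> H) (b1 c1 : 'cV[R[i]]_n -> H)
    (S2 : set H) (A2 : 'I_d -> 'M[R[i]]_n -> H -> H) (b2 c2 : 'cV[R[i]]_n -> H)
    (Y : 'I_d -> 'M[R[i]]_n) : Prop :=
  exists U : set (@ncpt R d),
    [/\ unif_open U, U (existT _ n Y) &
        forall p, U p -> exists m (X : 'I_d -> 'M[R[i]]_(m * n)),
          [/\ p = existT _ (m * n) X, in_dom ip S1 A1 Y X, in_dom ip S2 A2 Y X &
              transfer ip S1 A1 b1 c1 Y X = transfer ip S2 A2 b2 c2 Y X]].

(* Main.v *)
Require Import Defs.
From HB Require Import structures.
From mathcomp Require Import all_boot all_order all_algebra.
From mathcomp Require Import complex mxtens.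
From mathcomp Require Import boolp classical_sets functions reals.
From mathcomp Require Import ring lra.
From Stdlib Require Import ClassicalEpsilon.

(** Write [C] for the controllable subspace, [O] for the observable one,
    [N] for the intersection of [C] with the orthogonal complement of [O], and
    [M] for [C] minus [N] (orthogonal difference).  Both [C] and [N] are
    invariant under all [A j G], so [M] is semi-invariant and the compression to
    [M] intertwines words in [A] on [C] with words in [A0]; dually for adjoints.
    This gives minimality.

    If [L_A(X)] maps the [m]-fold sum of [C] onto itself, then the solution [u]
    of [L_A(X) u = c] lies there, its projection solves the compressed equation,
    and pairing with [b], which is orthogonal to [N], gives equality of the
    transfer functions at [X].  Near the centre surjectivity comes from a
    Neumann-type contraction, uniformly in [m] because the [A j] are completely
    bounded.  Along a path of invertible pencils surjectivity on the sum of [C]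
    is locally constant by the same contraction, so it propagates from the centre
    to the end of the path; no analytic continuation is needed, and for the
    compression only invertibility at the end point matters. *)

Set Implicit Arguments.
Unset Strict Implicit.
Unset Printing Implicit Defensive.

Import Order.TTheory GRing.Theory Num.Theory.
Local Open Scope ring_scope.
Local Open Scope classical_set_scope.

(** * Inner product spaces *)

Section Scalars.
Context {R : realType}.
Implicit Types z w : R[i].

Lemma cnorm_ge0 z : 0 <= cnorm z.
Proof. by case: z => a b; exact: sqrtr_ge0. Qed.

Lemma cnorm0 : cnorm (0 : R[i]) = 0.
Proof. exact: ComplexField.Normc.normc0. Qed.

Lemma cnormM z w : cnorm (z * w) = cnorm z * cnorm w.
Proof. exact: ComplexField.Normc.normcM. Qed.

Lemma cnorm_real (a : R) : cnorm (real_complex R a) = `|a|.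
Proof. by rewrite /cnorm /= expr0n addr0 sqrtr_sqr. Qed.

Lemma sqr_cnorm z : cnorm z ^+ 2 = complex.Re z ^+ 2 + complex.Im z ^+ 2.
Proof. by case: z => a b /=; rewrite sqr_sqrtr // addr_ge0 // sqr_ge0. Qed.

Lemma mul_conjc z : z * conjc z = real_complex R (cnorm z ^+ 2).
Proof.
rewrite sqr_cnorm; case: z => a b; apply/eqP; rewrite eq_complex /=.
by apply/andP; split; apply/eqP; ring.
Qed.

Lemma ReD z w : complex.Re (z + w) = complex.Re z + complex.Re w.
Proof. by case: z; case: w. Qed.

Lemma Re_sum (I : Type) (r : seq I) (P : pred I) (F : I -> R[i]) :
  complex.Re (\sum_(i <- r | P i) F i) = \sum_(i <- r | P i) complex.Re (F i).
Proof. exact: (big_morph _ ReD). Qed.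

Lemma Re_realM (a : R) z : complex.Re (real_complex R a * z) = a * complex.Re z.
Proof. by case: z => b c /=; rewrite mul0r subr0. Qed.

Lemma Re_conjc z : complex.Re (conjc z) = complex.Re z.
Proof. by case: z. Qed.

Lemma conjcD z w : conjc (z + w) = conjc z + conjc w.
Proof. exact: rmorphD. Qed.

Lemma conjcM z w : conjc (z * w) = conjc z * conjc w.
Proof. exact: rmorphM. Qed.

Lemma conjcN z : conjc (- z) = - conjc z.
Proof. exact: rmorphN. Qed.

Lemma Re_le_cnorm z : complex.Re z <= cnorm z.
Proof.
case: z => a b; apply: le_trans (ler_norm _) _; rewrite -sqrtr_sqr /cnorm /=.
by rewrite ler_wsqrtr // lerDl sqr_ge0.
Qed.

Lemma cnorm_eq0 z : cnorm z = 0 -> z = 0.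
Proof. exact: ComplexField.Normc.eq0_normc. Qed.

Lemma cnormV z : cnorm z^-1 = (cnorm z)^-1.
Proof. exact: ComplexField.Normc.normcV. Qed.

End Scalars.

Section InnerProduct.
Context {R : realType} {H : lmodType R[i]} {ip : H -> H -> R[i]}.
Context (hH : is_hilbert ip).
Implicit Types (x y z : H) (a : R[i]) (S : set H).
Local Notation hn := (hnorm ip).

Lemma ipDl x y z : ip (x + y) z = ip x z + ip y z.
Proof. by have := ip_linear_l hH 1 x y z; rewrite scale1r mul1r. Qed.

Lemma ip0l z : ip 0 z = 0.
Proof. by apply: (addIr (ip 0 z)); rewrite -ipDl !add0r. Qed.

Lemma ipZl a x z : ip (a *: x) z = a * ip x z.
Proof. by have := ip_linear_l hH a x 0 z; rewrite addr0 ip0l addr0. Qed.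

Lemma ipNl x z : ip (- x) z = - ip x z.
Proof. by rewrite -scaleN1r ipZl mulN1r. Qed.

Lemma ipBl x y z : ip (x - y) z = ip x z - ip y z.
Proof. by rewrite ipDl ipNl. Qed.

Lemma ip_suml (I : Type) (r : seq I) (P : pred I) (F : I -> H) z :
  ip (\sum_(i <- r | P i) F i) z = \sum_(i <- r | P i) ip (F i) z.
Proof. exact: (big_morph (ip^~ z) (fun x y => ipDl x y z) (ip0l z)). Qed.

Lemma ipC x y : ip y x = conjc (ip x y).
Proof. exact: ip_conj. Qed.

Lemma ip_eq0C x y : ip x y = 0 -> ip y x = 0.
Proof. by rewrite (ipC x y) => ->; rewrite conjc0. Qed.

Lemma ipDr x y z : ip x (y + z) = ip x y + ip x z.
Proof. by rewrite ipC ipDl conjcD -!ipC. Qed.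

Lemma ipZr a x y : ip x (a *: y) = conjc a * ip x y.
Proof. by rewrite ipC ipZl conjcM -ipC. Qed.

Lemma ip0r x : ip x 0 = 0.
Proof. by rewrite ip_eq0C // ip0l. Qed.

Lemma ipNr x y : ip x (- y) = - ip x y.
Proof. by rewrite ipC ipNl conjcN -ipC. Qed.

Lemma ipBr x y z : ip x (y - z) = ip x y - ip x z.
Proof. by rewrite ipDr ipNr. Qed.

Lemma sqr_hnorm x : hn x ^+ 2 = complex.Re (ip x x).
Proof. by rewrite sqr_sqrtr // ip_pos. Qed.

(** Conjugate symmetry makes [ip x x] its own conjugate, so its imaginary part vanishes. *)
Lemma ip_self x : ip x x = real_complex R (hn x ^+ 2).
Proof.
rewrite sqr_hnorm; have := ipC x x; case: (ip x x) => a b /= [] /eqP.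
by rewrite -subr_eq0 opprK -mulr2n mulrn_eq0 /= => /eqP ->.
Qed.

Lemma hnorm_ge0 x : 0 <= hn x. Proof. exact: sqrtr_ge0. Qed.

Lemma hnorm_eq0 x : hn x = 0 -> x = 0.
Proof. by move=> h; apply: (ip_def hH); rewrite ip_self h expr0n. Qed.

Lemma hnorm0 : hn 0 = 0.
Proof. by rewrite /hnorm ip0l sqrtr0. Qed.

Lemma hnormZ a x : hn (a *: x) = cnorm a * hn x.
Proof.
apply/(pexpIrn (n := 2)); rewrite ?nnegrE ?mulr_ge0 ?hnorm_ge0 ?cnorm_ge0 //.
by rewrite sqr_hnorm ipZl ipZr mulrA mul_conjc Re_realM exprMn sqr_hnorm.
Qed.

Lemma hnormN x : hn (- x) = hn x.
Proof. by rewrite /hnorm ipNl ipNr opprK. Qed.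

Lemma hnormBC x y : hn (x - y) = hn (y - x).
Proof. by rewrite -hnormN opprB. Qed.

Lemma sqr_hnormD x y :
  hn (x + y) ^+ 2 = hn x ^+ 2 + hn y ^+ 2 + 2 * complex.Re (ip x y).
Proof.
rewrite !sqr_hnorm ipDl !ipDr !ReD [ip y x]ipC Re_conjc; ring.
Qed.

Lemma pythagoras x y : ip x y = 0 -> hn (x + y) ^+ 2 = hn x ^+ 2 + hn y ^+ 2.
Proof. by move=> h; rewrite sqr_hnormD h mulr0 addr0. Qed.

Lemma parallelogram x y :
  hn (x + y) ^+ 2 + hn (x - y) ^+ 2 = 2 * hn x ^+ 2 + 2 * hn y ^+ 2.
Proof.
rewrite !sqr_hnormD hnormN ipNr.
have -> : complex.Re (- ip x y) = - complex.Re (ip x y) by case: (ip x y).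
ring.
Qed.

Definition ipcoef x y : R[i] := ip x y / ip y y.

(* For [y = 0] this relies on division by zero giving zero. *)
Lemma ipcoef_orth x y : ip (x - ipcoef x y *: y) y = 0.
Proof.
rewrite ipBl ipZl /ipcoef; have [->|y0] := EM (y = 0).
  by rewrite !ip0r mulr0 subr0.
rewrite divfK ?subrr //; apply/eqP => h; exact/y0/(ip_def hH).
Qed.

(** Pythagoras for the splitting of [x] into its component along [y] and the remainder.
    Cauchy-Schwarz, the characterization of nearest points and the amplification bound all rest on
    this identity. *)
Lemma hnorm_ipcoef x y :
  hn x ^+ 2 = hn (x - ipcoef x y *: y) ^+ 2 + cnorm (ipcoef x y) ^+ 2 * hn y ^+ 2.
Proof.
rewrite -exprMn -hnormZ -pythagoras ?subrK //.
by rewrite ipZr ipcoef_orth mulr0.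
Qed.

Lemma cauchy_schwarz x y : cnorm (ip x y) <= hn x * hn y.
Proof.
have [->|y0] := EM (y = 0); first by rewrite ip0r cnorm0 hnorm0 mulr0.
have hy : hn y != 0 by apply/eqP => h; exact/y0/hnorm_eq0.
have hy0 : 0 < hn y by rewrite lt_neqAle eq_sym hy hnorm_ge0.
have e : cnorm (ip x y) = cnorm (ipcoef x y) * hn y * hn y.
  rewrite /ipcoef cnormM cnormV ip_self cnorm_real ger0_norm ?sqr_ge0 //.
  by rewrite -mulrA -expr2 divfK // expf_neq0.
rewrite e ler_pM2r // -(ler_pXn2r (n := 2)) ?nnegrE ?mulr_ge0 ?hnorm_ge0 ?cnorm_ge0 //.
by rewrite exprMn [leRHS](hnorm_ipcoef x y) lerDr sqr_ge0.
Qed.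

Lemma ler_hnormD x y : hn (x + y) <= hn x + hn y.
Proof.
rewrite -(ler_pXn2r (n := 2)) ?nnegrE ?addr_ge0 ?hnorm_ge0 //.
rewrite sqr_hnormD sqrrD.
have := le_trans (Re_le_cnorm _) (cauchy_schwarz x y).
move=> h; lra.
Qed.

Lemma ler_hnormB x y z : hn (x - z) <= hn (x - y) + hn (y - z).
Proof. by rewrite -[x - z](subrKA y) ler_hnormD. Qed.

Lemma ler_hnorm_sum (I : Type) (r : seq I) (P : pred I) (F : I -> H) :
  hn (\sum_(i <- r | P i) F i) <= \sum_(i <- r | P i) hn (F i).
Proof.
elim/big_ind2: _ => [|x a y b h1 h2|//]; first by rewrite hnorm0.
exact: le_trans (ler_hnormD _ _) (lerD h1 h2).
Qed.

(** * Closed subspaces, orthogonal complements and closed spans *)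

Lemma perp_sub S x y : perp ip S x -> perp ip S y -> perp ip S (x - y).
Proof. by move=> hx hy z Sz; rewrite ipBl hx // hy // subrr. Qed.

Lemma subspace0 S : closed_subspace ip S -> S 0. Proof. by case. Qed.

Lemma subspaceZ S a x : closed_subspace ip S -> S x -> S (a *: x).
Proof. by case=> h0 h _ Sx; have := h a x 0 Sx h0; rewrite addr0. Qed.

Lemma subspaceD S x y : closed_subspace ip S -> S x -> S y -> S (x + y).
Proof. by case=> h0 h _ Sx Sy; have := h 1 x y Sx Sy; rewrite scale1r. Qed.

Lemma subspaceN S x : closed_subspace ip S -> S x -> S (- x).
Proof. by move=> hS Sx; rewrite -scaleN1r; exact: subspaceZ. Qed.

Lemma subspaceB S x y : closed_subspace ip S -> S x -> S y -> S (x - y).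
Proof. by move=> hS Sx Sy; apply: subspaceD => //; exact: subspaceN. Qed.

Lemma subspace_sum S (I : Type) (r : seq I) (P : pred I) (F : I -> H) :
  closed_subspace ip S -> (forall i, P i -> S (F i)) -> S (\sum_(i <- r | P i) F i).
Proof.
move=> hS h; apply: (big_ind S) => //; first exact: subspace0.
by move=> x y; exact: subspaceD.
Qed.

Lemma closed_subspaceT : closed_subspace ip setT.
Proof. by split. Qed.

Lemma closed_subspaceI S1 S2 :
  closed_subspace ip S1 -> closed_subspace ip S2 -> closed_subspace ip (S1 `&` S2).
Proof.
move=> h1 h2; split; first by split; exact: subspace0.
  by move=> a x y [x1 x2] [y1 y2]; split; apply: subspaceD => //; apply: subspaceZ.
case: h1 h2 => _ _ c1 [_ _ c2] x h; split; [apply: c1|apply: c2] => e e0;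
  by have [y [[y1 y2] hy]] := h e e0; exists y.
Qed.

Lemma ip_small_eq0 x y : (forall e : R, 0 < e -> exists z, ip z y = 0 /\ hn (x - z) < e) ->
  ip x y = 0.
Proof.
move=> h; apply: cnorm_eq0; apply/eqP; rewrite eq_le cnorm_ge0 andbT.
apply/ler_addgt0Pr => e e0; rewrite add0r.
(* Adding 1 keeps the denominator positive when [y] is zero. *)
have e1 : 0 < e / (hn y + 1) by rewrite divr_gt0 // ltr_wpDl ?hnorm_ge0.
have [z [hz hxz]] := h _ e1.
rewrite -[ip x y]subr0 -hz -ipBl; apply: le_trans (cauchy_schwarz _ _) _.
move: hxz; rewrite ltr_pdivlMr ?ltr_wpDl ?hnorm_ge0 // => /ltW; apply: le_trans.
by rewrite ler_wpM2l ?hnorm_ge0 // lerDl.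
Qed.

Lemma closed_perp S : closed_subspace ip (perp ip S).
Proof.
split; first by move=> y _; rewrite ip0l.
  by move=> a x y hx hy z Sz; rewrite ipDl ipZl hx // hy // mulr0 addr0.
move=> x h y Sy; apply: ip_small_eq0 => e e0.
by have [z [hz ?]] := h e e0; exists z; split => //; exact: hz.
Qed.

Lemma sub_closed_span S : S `<=` closed_span ip S.
Proof.
move=> x Sx e e0; exists 1%N, (fun=> 1), (fun=> x); split=> //.
by rewrite big_ord1 scale1r subrr hnorm0.
Qed.

Lemma closed_span_min S T : closed_subspace ip T -> S `<=` T -> closed_span ip S `<=` T.
Proof.
move=> hT ST x hx; case: (hT) => _ _; apply => e e0.
have [k [a [g [hg hxe]]]] := hx e e0.
exists (\sum_(i < k) a i *: g i); split => //.
by apply: subspace_sum => // i _; apply: subspaceZ => //; exact/ST/hg.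
Qed.

Lemma closed_closed_span S : closed_subspace ip (closed_span ip S).
Proof.
split.
- move=> e e0; exists 0%N, (fun=> 0), (fun=> 0); split; first by case.
  by rewrite big_ord0 subrr hnorm0.
- move=> a x y hx hy e e0.
  (* The error in [x] is multiplied by [cnorm a], so its tolerance is half of [e] divided by
     [cnorm a + 1]; the other half goes to [y]. *)
  have a1 : 0 < cnorm a + 1 by rewrite ltr_wpDl ?cnorm_ge0.
  have e1 : 0 < e / 2 / (cnorm a + 1) by rewrite !divr_gt0.
  have e2 : 0 < e / 2 by rewrite divr_gt0.
  have [k [u [g [hg hxe]]]] := hx _ e1.
  have [l [v [f [hf hye]]]] := hy _ e2.
  pose cat (T : Type) (p : 'I_k -> T) (q : 'I_l -> T) (i : 'I_(k + l)) :=
    match fintype.split i with inl i => p i | inr i => q i end.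
  exists (k + l)%N, (cat _ (fun i => a * u i) v), (cat _ g f); split.
    by move=> i; rewrite /cat; case: (fintype.split i).
  rewrite big_split_ord /=.
  under eq_bigr => i _ do rewrite /cat (unsplitK (inl i)) -scalerA.
  under [X in _ - (_ + X)]eq_bigr => i _ do rewrite /cat (unsplitK (inr i)).
  rewrite -scaler_sumr opprD addrACA -scalerBr.
  apply: le_lt_trans (ler_hnormD _ _) _; rewrite [ltRHS]splitr.
  apply: ler_ltD hye; rewrite hnormZ.
  move: hxe; rewrite ltr_pdivlMr // => /ltW; apply: le_trans.
  by rewrite mulrC ler_wpM2l ?hnorm_ge0 // lerDl.
- move=> x h e e0; have e2 : 0 < e / 2 by rewrite divr_gt0.
  have [y [hy hxy]] := h _ e2; have [k [u [g [hg hye]]]] := hy _ e2.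
  exists k, u, g; split=> //.
  by apply: le_lt_trans (ler_hnormB _ y _) _; rewrite [ltRHS]splitr ltrD.
Qed.

Lemma perp_closed_span S x : (forall y, S y -> ip x y = 0) -> perp ip (closed_span ip S) x.
Proof.
move=> h y; have: S `<=` perp ip [set x].
  by move=> z Sz _ ->; exact/ip_eq0C/h.
move/(closed_span_min (closed_perp _)) => h1 /h1 /(_ x erefl).
exact: ip_eq0C.
Qed.

End InnerProduct.

(** * Orthogonal projections and the Riesz representation theorem *)

Section Projection.
Context {R : realType} {H : lmodType R[i]} {ip : H -> H -> R[i]}.
Context (hH : is_hilbert ip).
Implicit Types (x y z : H) (a : R[i]) (S M : set H).
Local Notation hn := (hnorm ip).

Lemma invr_nat_small (e : R) : 0 < e ->
  exists N, forall p, (N <= p)%N -> (p.+1%:R)^-1 < e.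
Proof.
move=> e0; exists (Num.bound e^-1) => p hp.
rewrite invf_plt ?posrE ?ltr0Sn //.
have := archi_boundP (ltW (_ : 0 < e^-1)); rewrite invr_gt0 => /(_ e0) h.
by apply: lt_le_trans h _; rewrite ler_nat; exact: leqW.
Qed.

(** A minimizing sequence is Cauchy by the parallelogram law: midpoints stay in [S], so their
    squared distance to [x] is at least the infimum [D]. *)
Lemma nearest_point S x : closed_subspace ip S ->
  exists l, S l /\ forall y, S y -> hn (x - l) ^+ 2 <= hn (x - y) ^+ 2.
Proof.
move=> hS; pose E := [set hn (x - y) ^+ 2 | y in S].
have lbE : has_lbound E by exists 0 => _ [y _ <-]; rewrite sqr_ge0.
have E0 : E !=set0 by exists (hn (x - 0) ^+ 2), 0 => //; exact: subspace0 hS.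
pose D := inf E.
have leD y : S y -> D <= hn (x - y) ^+ 2 by move=> Sy; apply: ge_inf => //; exists y.
have D0 : 0 <= D by apply: lb_le_inf => // _ [y _ <-]; rewrite sqr_ge0.
have /choice [u hu] : forall k : nat, exists y, S y /\ hn (x - y) ^+ 2 < D + (k.+1%:R)^-1.
  move=> k; have k0 : 0 < (k.+1%:R)^-1 :> R by rewrite invr_gt0 ltr0Sn.
  by have [_ [y Sy <-] hy] := inf_adherent k0 (conj E0 lbE); exists y.
have cauchy p q : hn (u p - u q) ^+ 2 <= 2 * (p.+1%:R)^-1 + 2 * (q.+1%:R)^-1.
  have [Sp hp] := hu p; have [Sq hq] := hu q.
  have := parallelogram hH (x - u p) (x - u q).
  have -> : x - u p - (x - u q) = u q - u p.
    by rewrite opprB addrC addrA subrK.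
  have -> : x - u p + (x - u q) = (2 : R[i]) *: (x - 2^-1 *: (u p + u q)).
    rewrite scalerBr scalerA divff ?pnatr_eq0 // scale1r scaler_nat mulr2n.
    by rewrite opprD addrACA.
  have Spq : S (2^-1 *: (u p + u q)) by apply: (subspaceZ _ hS); exact: (subspaceD hS).
  rewrite (hnormZ hH) [hn (u q - u p)](hnormBC hH).
  have -> : cnorm (2 : R[i]) = 2.
    have -> : (2 : R[i]) = real_complex R 2 by rewrite rmorph_nat.
    by rewrite cnorm_real ger0_norm.
  have := leD _ Spq; rewrite exprMn => h1 h2.
  move: hp hq h1 h2; move: (p.+1%:R^-1) (q.+1%:R^-1) => r1 r2 hp hq h1 h2; lra.
have [e e0|l hl] := @ip_complete _ _ _ hH u.
  have e40 : 0 < e ^+ 2 / 4 by rewrite divr_gt0 ?exprn_gt0.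
  have [N hN] := invr_nat_small e40; exists N => p q hp hq.
  rewrite -(ltr_pXn2r (n := 2)) ?nnegrE ?hnorm_ge0 ?ltW //.
  apply: le_lt_trans (cauchy p q) _.
  have := hN p hp; have := hN q hq.
  move: (p.+1%:R^-1) (q.+1%:R^-1) => r1 r2 h1 h2; lra.
have Sl : S l.
  case: (hS) => _ _; apply => e e0; have [N hN] := hl e e0.
  by exists (u N); split; [exact: (hu N).1 | rewrite (hnormBC hH) hN].
exists l; split => // y Sy; apply: le_trans (leD y Sy).
rewrite -[D]sqr_sqrtr // ler_pXn2r ?nnegrE ?hnorm_ge0 ?sqrtr_ge0 //.
apply/ler_addgt0Pr => e e0.
have e2 : 0 < e / 2 by rewrite divr_gt0.
have e3 : 0 < (e / 2) ^+ 2 by rewrite exprn_gt0.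
have [N1 hN1] := invr_nat_small e3; have [N2 hN2] := hl _ e2.
pose p := maxn N1 N2.
apply: le_trans (ler_hnormB hH _ (u p) _) _.
have h2 := hN2 p (leq_maxr _ _).
suff h1 : hn (x - u p) < Num.sqrt D + e / 2 by lra.
rewrite -(ltr_pXn2r (n := 2)) ?nnegrE ?hnorm_ge0 ?addr_ge0 ?sqrtr_ge0 ?ltW //.
rewrite sqrrD [Num.sqrt D ^+ 2]sqr_sqrtr //.
have := (hu p).2; have := hN1 p (leq_maxl _ _); move: (p.+1%:R^-1) => r1.
have : 0 <= Num.sqrt D * (e / 2) by rewrite mulr_ge0 ?sqrtr_ge0 ?ltW.
by move: (Num.sqrt D * (e / 2)) ((e / 2) ^+ 2) => a f a1 a2 a3; lra.
Qed.

(** Moving the nearest point [l] along [y] by the component of [x - l] lowers the squared distance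
    by the squared length of that component; minimality forces the component to be zero. *)
Lemma orthproj_spec S x : closed_subspace ip S ->
  S (orthproj ip S x) /\ perp ip S (x - orthproj ip S x).
Proof.
move=> hS; apply: (@epsilon_spec _ _ (fun z => S z /\ perp ip S (x - z))).
have [l [Sl hl]] := nearest_point x hS.
exists l; split => // y Sy.
have := hl (l + ipcoef (ip := ip) (x - l) y *: y).
rewrite opprD addrA [hn (x - l) ^+ 2](hnorm_ipcoef hH _ y) gerDl => h.
have {h} : cnorm (ipcoef (ip := ip) (x - l) y) ^+ 2 * hn y ^+ 2 <= 0.
  by apply: h; apply: (subspaceD hS) => //; exact: (subspaceZ _ hS).
rewrite -exprMn => h.
have : ipcoef (ip := ip) (x - l) y *: y = 0.
  apply: (hnorm_eq0 hH); rewrite (hnormZ hH); apply/eqP.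
  by rewrite -sqrf_eq0 eq_le h sqr_ge0.
move=> h0; rewrite -(subr0 (x - l)) -h0; exact: ipcoef_orth.
Qed.

Section Fixed.
Context {M : set H} (hM : closed_subspace ip M).
Local Notation P := (orthproj ip M).

Lemma orthproj_in x : M (P x). Proof. exact: (orthproj_spec x hM).1. Qed.

Lemma orthproj_perp x : perp ip M (x - P x). Proof. exact: (orthproj_spec x hM).2. Qed.

Lemma perp_self0 x : M x -> perp ip M x -> x = 0.
Proof. by move=> Mx px; apply: (ip_def hH); exact: px. Qed.

Lemma orthproj_unique x z : M z -> perp ip M (x - z) -> P x = z.
Proof.
move=> Mz pz; apply/subr0_eq/perp_self0.
  by apply: (subspaceB hM) => //; exact: orthproj_in.
have -> : P x - z = (x - z) - (x - P x) by rewrite opprB [RHS]addrC addrA subrK.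
by apply: perp_sub => //; exact: orthproj_perp.
Qed.

Lemma orthproj_id x : M x -> P x = x.
Proof. by move=> Mx; apply: orthproj_unique => // y _; rewrite subrr (ip0l hH). Qed.

Lemma orthproj_perp0 x : perp ip M x -> P x = 0.
Proof. by move=> px; apply: orthproj_unique; rewrite ?subr0 //; exact: subspace0 hM. Qed.

Lemma orthprojD x y : P (x + y) = P x + P y.
Proof.
apply: orthproj_unique; first by apply: (subspaceD hM); exact: orthproj_in.
move=> z Mz; rewrite opprD addrACA ipDl //.
by rewrite !(orthproj_perp _ Mz) addr0.
Qed.

Lemma orthprojZ a x : P (a *: x) = a *: P x.
Proof.
apply: orthproj_unique; first by apply: (subspaceZ _ hM); exact: orthproj_in.
by move=> z Mz; rewrite -scalerBr ipZl // (orthproj_perp _ Mz) mulr0.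
Qed.

Lemma orthproj0 : P 0 = 0.
Proof. by apply: orthproj_id; exact: subspace0 hM. Qed.

Lemma orthprojB x y : P (x - y) = P x - P y.
Proof. by rewrite -scaleN1r orthprojD orthprojZ scaleN1r. Qed.

Lemma orthproj_sum (I : Type) (r : seq I) (Q : pred I) (F : I -> H) :
  P (\sum_(i <- r | Q i) F i) = \sum_(i <- r | Q i) P (F i).
Proof. exact: (big_morph P orthprojD orthproj0). Qed.

Lemma ip_orthprojl x y : M y -> ip (P x) y = ip x y.
Proof.
move=> My; rewrite -[in RHS](subrK (P x) x) ipDl //.
by rewrite (orthproj_perp _ My) add0r.
Qed.

Lemma ip_orthprojr x y : M x -> ip x (P y) = ip x y.
Proof. by move=> Mx; rewrite ipC // ip_orthprojl // -ipC. Qed.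

Lemma hnorm_orthproj x : hn (P x) <= hn x.
Proof.
rewrite -(ler_pXn2r (n := 2)) ?nnegrE ?hnorm_ge0 //.
rewrite -[in leRHS](subrK (P x) x) pythagoras // ?lerDr ?sqr_ge0 //.
by apply: orthproj_perp; exact: orthproj_in.
Qed.

End Fixed.

(** The kernel [W] of [phi] in [S] is closed. If [phi] is nonzero on [S], some [f] in [S] is
    orthogonal to [W], and every vector of [S] is a multiple of [f] modulo [W], so a multiple of [f]
    represents [phi]. *)
Lemma riesz S (phi : H -> R[i]) (K : R) : closed_subspace ip S ->
  (forall a x y, S x -> S y -> phi (a *: x + y) = a * phi x + phi y) ->
  (forall x, S x -> cnorm (phi x) <= K * hn x) ->
  exists z, S z /\ forall x, S x -> phi x = ip x z.
Proof.
move=> hS lin bnd.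
have S0 := subspace0 hS.
have phi0 : phi 0 = 0.
  apply/cnorm_eq0/eqP; rewrite eq_le cnorm_ge0 andbT.
  by have := bnd 0 S0; rewrite hnorm0 // mulr0.
have phiB x y : S x -> S y -> phi (x - y) = phi x - phi y.
  by move=> Sx Sy; rewrite addrC -scaleN1r lin // mulN1r addrC.
pose W := [set x | S x /\ phi x = 0].
have hW : closed_subspace ip W.
  split; first by split.
    move=> a x y [Sx x0] [Sy y0]; split; last by rewrite lin // x0 y0 mulr0 addr0.
    by apply: (subspaceD hS) => //; exact: (subspaceZ _ hS).
  move=> x h; have Sx : S x.
    by case: (hS) => _ _; apply => e /h [y [[Sy _] hy]]; exists y.
  split => //; apply/cnorm_eq0/eqP; rewrite eq_le cnorm_ge0 andbT.
  apply/ler_addgt0Pr => e e0; rewrite add0r.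
  have K1 : 0 < `|K| + 1 by rewrite ltr_wpDl.
  have [|y [[Sy y0] hy]] := h (e / (`|K| + 1)); first by rewrite divr_gt0.
  rewrite -[phi x]subr0 -y0 -phiB //.
  apply: le_trans (bnd _ (subspaceB hS Sx Sy)) _.
  move: hy; rewrite ltr_pdivlMr // => /ltW; apply: le_trans.
  rewrite mulrC ler_wpM2l ?hnorm_ge0 //.
  by apply: le_trans (ler_norm _) _; rewrite lerDl.
have [h|/existsNP [e /not_implyP [Se pe]]] := EM (forall x, S x -> phi x = 0).
  by exists 0; split => // x Sx; rewrite ip0r // h.
pose f := e - orthproj ip W e.
have [Sp p0] := orthproj_in hW e.
have Sf : S f by exact: (subspaceB hS).
have pf : phi f != 0 by rewrite phiB // p0 subr0; exact/eqP.
have f0 : ip f f != 0.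
  by apply/eqP => /(ip_def hH) h; move: pf; rewrite h phi0 eqxx.
(* The conjugate compensates for [ip] being antilinear in its second argument. *)
exists (conjc (phi f / ip f f) *: f); split; first exact: (subspaceZ _ hS).
move=> x Sx; rewrite ipZr // conjcK.
have Wx : W (- (phi x / phi f) *: f + x).
  split; first by apply: (subspaceD hS) => //; exact: (subspaceZ _ hS).
  by rewrite lin // mulNr divfK // addNr.
have := ip_eq0C hH (orthproj_perp hW e Wx).
rewrite -/f ipDl // ipZl // mulNr addrC => /subr0_eq ->.
by rewrite mulrA [phi f / _ * _]mulrC mulrA divfK // divfK.
Qed.

Lemma adj_spec S (T : H -> H) y : closed_subspace ip S ->
  linear_on S T -> bounded_on ip S T ->
  S (adj ip S T y) /\ forall x, S x -> ip (T x) y = ip x (adj ip S T y).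
Proof.
move=> hS lin [K bnd].
apply: (@epsilon_spec _ _ (fun z => S z /\ forall x, S x -> ip (T x) y = ip x z)).
apply: (@riesz S (fun x => ip (T x) y) (K * hn y)) => // [a x z Sx Sz|x Sx].
  by rewrite lin // ipDl // ipZl.
apply: le_trans (cauchy_schwarz hH _ _) _.
by rewrite mulrAC ler_wpM2r ?hnorm_ge0 ?bnd.
Qed.

End Projection.

(** * The compression to the minimal subspace *)

Section AdjointOnSubspace.
Context {R : realType} {H : lmodType R[i]} {ip : H -> H -> R[i]}.
Context (hH : is_hilbert ip).
Local Notation hn := (hnorm ip).

(** The vector [z] itself shows that the choice defining [adj] succeeds; two representing vectors
    differ by a vector of [S] orthogonal to [S]. *)
Lemma adj_unique S (T : H -> H) y z : closed_subspace ip S ->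
  S z -> (forall x, S x -> ip (T x) y = ip x z) -> adj ip S T y = z.
Proof.
move=> hS Sz hz.
have [Sa ha] := @epsilon_spec H (inhabits 0)
  (fun t => S t /\ forall x, S x -> ip (T x) y = ip x t) (ex_intro _ z (conj Sz hz)).
apply/subr0_eq/(perp_self0 hH (M := S)); first exact: (subspaceB hS).
by move=> x Sx; apply: (ip_eq0C hH); rewrite ipBr // -ha // hz // subrr.
Qed.

(** Together with [closed_span_min], this reduces a claim that a bounded operator maps a closed span
    into [S] to a check on the generators. *)
Lemma closed_preimage S (T : H -> H) : closed_subspace ip S ->
  linear_on setT T -> bounded_on ip setT T -> closed_subspace ip [set x | S (T x)].
Proof.
move=> hS lin [K bnd].
have TD a x y : T (a *: x + y) = a *: T x + T y by exact: lin.
split => /=.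
- suff -> : T 0 = 0 by exact: subspace0 hS.
  by have := TD (-1) 0 0; rewrite !scaleN1r !addNr.
- move=> a x y Sx Sy; rewrite TD.
  by apply: (subspaceD hS) => //; exact: (subspaceZ _ hS).
- move=> x h; case: (hS) => _ _; apply => e e0.
  have K1 : 0 < `|K| + 1 by rewrite ltr_wpDl.
  have [|y [Sy hy]] := h (e / (`|K| + 1)); first by rewrite divr_gt0.
  exists (T y); split => //.
  have -> : T x - T y = T (x - y).
    by rewrite addrC -scaleN1r -TD scaleN1r addrC.
  apply: le_lt_trans (bnd _ I) _.
  move: hy; rewrite ltr_pdivlMr //; apply: le_lt_trans.
  rewrite mulrC ler_wpM2l ?hnorm_ge0 //.
  by apply: le_trans (ler_norm _) _; rewrite lerDl.
Qed.

End AdjointOnSubspace.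

Lemma adjmxK (R : realType) (n : nat) (G : 'M[R[i]]_n) : adjmx (adjmx G) = G.
Proof. by apply/matrixP => i j; rewrite !mxE conjcK. Qed.

Section MinimalSubspace.
Context {R : realType} {H : lmodType R[i]} {ip : H -> H -> R[i]} {d n : nat}.
Context {A : 'I_d -> 'M[R[i]]_n -> H -> H} {b c : 'cV[R[i]]_n -> H}.
Context (hH : is_hilbert ip) (hr : is_realization ip setT A b c).
Local Notation hn := (hnorm ip).
Local Notation C := (ctrl_space ip A c).
Local Notation O := (obs_space ip setT A b).
Local Notation N := (C `&` perp ip O).
Local Notation M := (minimal_subspace ip A b c).
Local Notation P := (orthproj ip M).
Local Notation A0 := (fun j G x => P (A j G x)).
Local Notation b0 := (fun v => P (b v)).
Local Notation c0 := (fun v => P (c v)).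

Lemma realization_lin j G : linear_on setT (A j G).
Proof. by case: hr => _ h _ _ _; case: (h j G). Qed.

Lemma realization_bounded j G : bounded_on ip setT (A j G).
Proof. by case: hr => _ h _ _ _; case: (h j G). Qed.

Lemma realizationD j G x y : A j G (x + y) = A j G x + A j G y.
Proof. by have := @realization_lin j G 1 x y I I; rewrite !scale1r. Qed.

Lemma ctrl_closed : closed_subspace ip C.
Proof. exact: closed_closed_span. Qed.

Lemma unobs_closed : closed_subspace ip N.
Proof. by apply: closed_subspaceI; [exact: ctrl_closed | exact: closed_perp]. Qed.

Lemma minimal_closed : closed_subspace ip M.
Proof. by apply: closed_subspaceI; [exact: ctrl_closed | exact: closed_perp]. Qed.

Lemma ctrl_c v : C (c v).
Proof. by apply: (sub_closed_span hH); exists [::], v. Qed.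

Lemma ctrl_inv j G x : C x -> C (A j G x).
Proof.
move: x; apply: (closed_span_min (T := [set x | C (A j G x)])) => [|_ [w [v ->]]].
  apply: closed_preimage => //; [exact: ctrl_closed | exact: realization_lin |].
  exact: realization_bounded.
by apply: (sub_closed_span hH); exists ((j, G) :: w), v.
Qed.

Lemma ip_adj j G x y : ip (A j G x) y = ip x (adj ip setT (A j G) y).
Proof.
have [_ h] := adj_spec hH y (closed_subspaceT (ip := ip)) (@realization_lin j G)
  (@realization_bounded j G).
exact: h.
Qed.

(** Across the inner product [A j G] becomes its adjoint, which turns a generator of [O] into a
    generator with one more letter. *)
Lemma perp_obs_inv j G x : perp ip O x -> perp ip O (A j G x).
Proof.
move=> hx; apply: (perp_closed_span hH) => _ [w [u ->]].
rewrite ip_adj; apply: hx; apply: (sub_closed_span hH).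
(* [apply_word_dag] applies the last letter outermost, so the new letter goes at the end; it carries
   [adjmx G] because the definition takes the adjoint matrix once more. *)
by exists (rcons w (j, adjmx G)), u; rewrite /apply_word_dag foldl_rcons /= adjmxK.
Qed.

Lemma unobs_inv j G x : N x -> N (A j G x).
Proof. by case=> Cx px; split; [exact: ctrl_inv | exact: perp_obs_inv]. Qed.

Lemma proj_unobs x : N x -> P x = 0.
Proof.
move=> Nx; apply: (orthproj_perp0 hH minimal_closed) => y [_ py].
exact/(ip_eq0C hH)/py.
Qed.

(** Since [C] is the orthogonal sum of [M] and [N], on [C] the projection [P] is the identity minus
    the projection onto [N]. *)
Lemma sub_proj_unobs x : C x -> N (x - P x).
Proof.
move=> Cx; have Nz := orthproj_in hH unobs_closed x.
have -> : P x = x - orthproj ip N x; last by rewrite opprB addrCA subrr addr0.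
apply: (orthproj_unique hH minimal_closed).
  split; last exact: (orthproj_perp hH unobs_closed).
  by apply: (subspaceB ctrl_closed) => //; case: Nz.
rewrite opprB addrCA subrr addr0 => y [_ py].
exact/(ip_eq0C hH)/py.
Qed.

(** Semi-invariance: [x - P x] lies in [N], which [A j G] preserves and [P] kills. *)
Lemma proj_A j G x : C x -> P (A j G x) = P (A j G (P x)).
Proof.
move=> Cx; rewrite -[in LHS](subrK (P x) x) realizationD.
rewrite (orthprojD hH minimal_closed) proj_unobs ?add0r //.
exact/unobs_inv/sub_proj_unobs.
Qed.

Lemma proj_word w x : C x -> P (apply_word A w x) = apply_word A0 w (P x).
Proof.
move=> Cx; have Cw w' : C (apply_word A w' x) by elim: w' => //= p w'; exact: ctrl_inv.
by elim: w => //= p w <-; rewrite proj_A.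
Qed.

(** Dual to the invariance of [N]. On the adjoint side the complement of [N] takes the place of [C]:
    it contains every [b u] and is preserved by the adjoints. *)
Lemma adj_perp_unobs j G g : perp ip N g -> perp ip N (adj ip setT (A j G) g).
Proof.
move=> hg y Ny; apply: (ip_eq0C hH); rewrite -ip_adj.
by apply: (ip_eq0C hH); apply: hg; exact: unobs_inv.
Qed.

(** For [x] in [M], the vector [A j G x] lies in [C] and differs from its projection by an element
    of [N], which [g] does not see. Hence pairing it with [g] equals pairing its projection with
    [P g]. *)
Lemma adj_compression j G g : perp ip N g ->
  adj ip M (A0 j G) (P g) = P (adj ip setT (A j G) g).
Proof.
move=> hg; have hM := minimal_closed; apply: (adj_unique hH) => //.
  exact: (orthproj_in hH).
move=> x Mx; rewrite [ip x _](ip_orthprojr hH hM) // -ip_adj.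
have CAx : C (A j G x) by apply: ctrl_inv; case: Mx.
rewrite (ip_orthprojl hH hM); last exact: (orthproj_in hH).
apply/esym; rewrite -[in LHS](subrK (P (A j G x)) (A j G x)) ipDl //.
rewrite [X in X + _](ip_eq0C hH) ?add0r; last by apply: hg; exact: sub_proj_unobs.
rewrite -(ip_orthprojr hH hM); last exact: (orthproj_in hH).
by rewrite (ip_orthprojl hH hM) //; exact: (orthproj_in hH).
Qed.

Lemma proj_word_dag w g : perp ip N g ->
  P (apply_word_dag ip setT A w g) = apply_word_dag ip M A0 w (P g).
Proof.
elim: w g => //= p w IH g hg.
by rewrite IH ?adj_compression //; exact: adj_perp_unobs.
Qed.

Lemma obs_b u : O (b u).
Proof. by apply: (sub_closed_span hH); exists [::], u. Qed.

Lemma perp_unobs_b u : perp ip N (b u).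
Proof. by move=> y [_ py]; apply: (ip_eq0C hH); apply: py; exact: obs_b. Qed.

Lemma orthproj_minimal_lin : linear_on setT P.
Proof.
move=> a x y _ _.
by rewrite (orthprojD hH minimal_closed) (orthprojZ hH minimal_closed).
Qed.

Lemma orthproj_minimal_bounded : bounded_on ip setT P.
Proof. by exists 1 => x _; rewrite mul1r (hnorm_orthproj hH minimal_closed). Qed.

Lemma compression_realization : is_realization ip M A0 b0 c0.
Proof.
have hM := minimal_closed; have PD := orthproj_minimal_lin.
case: hr => _ hA hG _ hbc; split => //.
- move=> j G; split.
  + by move=> x _; exact: (orthproj_in hH).
  + by move=> a x y _ _; rewrite (@realization_lin j G a x y I I) PD.
  + have [K hK] := @realization_bounded j G; exists K => x _.
    exact: le_trans (hnorm_orthproj hH hM _) (hK _ I).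
- by move=> j a G G' x _; rewrite hG // PD.
- by move=> v; split; exact: (orthproj_in hH).
- by move=> a v w; have [-> ->] := hbc a v w; rewrite !PD.
Qed.

(** [P] fixes [M], and by [proj_word] it sends the generators of [C] exactly to those of the
    compressed controllable space; continuity of [P] extends this to the closed span. *)
Lemma compression_ctrl : ctrl_space ip A0 c0 = M.
Proof.
have hM := minimal_closed.
apply/seteqP; split.
  apply: closed_span_min => // _ [w [v ->]].
  by rewrite -proj_word; [exact: (orthproj_in hH) | exact: ctrl_c].
move=> x Mx; rewrite -(orthproj_id hH hM Mx); case: Mx => Cx _.
move: x Cx; apply: (closed_span_min (T := [set x | ctrl_space ip A0 c0 (P x)]))
  => [|_ [w [v ->]] /=].
  apply: closed_preimage => //; [exact: closed_closed_span | |].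
    exact: orthproj_minimal_lin.
  exact: orthproj_minimal_bounded.
apply: (sub_closed_span hH); exists w, v; apply: proj_word; exact: ctrl_c.
Qed.

(* A vector of [M] orthogonal to the compressed observable space is orthogonal to [O], hence in [N], hence zero. *)
Lemma compression_obs : obs_space ip M A0 b0 = M.
Proof.
have hM := minimal_closed.
have WM : obs_space ip M A0 b0 `<=` M.
  apply: closed_span_min => // _ [w [u ->]].
  by rewrite -proj_word_dag; [exact: (orthproj_in hH) | exact: perp_unobs_b].
apply/seteqP; split => // x Mx.
have hW : closed_subspace ip (obs_space ip M A0 b0) by exact: closed_closed_span.
pose z := x - orthproj ip (obs_space ip M A0 b0) x.
have Mz : M z by apply: (subspaceB hM) => //; apply: WM; exact: (orthproj_in hH).
have pz : perp ip O z.
  apply: (perp_closed_span hH) => _ [w [u ->]].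
  rewrite -(ip_orthprojr hH hM) // proj_word_dag; last exact: perp_unobs_b.
  apply: (orthproj_perp hH hW); apply: (sub_closed_span hH).
  by exists w, u.
have /subr0_eq -> : z = 0; last exact: (orthproj_in hH).
by apply: (ip_def hH); case: (Mz) => Cz; apply.
Qed.

Lemma compression_minimal : minimal_realization ip M A0 b0 c0.
Proof.
split; first exact: compression_realization.
by split; [exact: compression_ctrl | exact: compression_obs].
Qed.

End MinimalSubspace.

(** * Amplifications and contractions *)

Section Amplification.
Context {R : realType} {H : lmodType R[i]} {ip : H -> H -> R[i]} {m : nat}.
Context (hH : is_hilbert ip).
Local Notation hn := (hnorm ip).

Definition ipm (u v : 'I_m -> H) : R[i] := \sum_i ip (u i) (v i).

Lemma sqr_hnormm (v : 'I_m -> H) : hnormm ip v ^+ 2 = \sum_i hn (v i) ^+ 2.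
Proof. by rewrite sqr_sqrtr // sumr_ge0 // => i _; rewrite sqr_ge0. Qed.

Lemma hnorm_ipm (v : 'I_m -> H) : hnorm ipm v = hnormm ip v.
Proof.
rewrite [LHS]/hnorm /hnormm /ipm Re_sum; congr Num.sqrt; apply: eq_bigr => i _.
by rewrite -(sqr_hnorm hH).
Qed.

Lemma hnormm_ge0 (v : 'I_m -> H) : 0 <= hnormm ip v.
Proof. exact: sqrtr_ge0. Qed.

Lemma hnorm_le_hnormm (v : 'I_m -> H) i : hn (v i) <= hnormm ip v.
Proof.
rewrite -(ler_pXn2r (n := 2)) ?nnegrE ?hnorm_ge0 ?hnormm_ge0 // sqr_hnormm.
by rewrite (bigD1 i) //= lerDl sumr_ge0 // => j _; rewrite sqr_ge0.
Qed.

Lemma hnormm_le_sum (v : 'I_m -> H) : hnormm ip v <= \sum_i hn (v i).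
Proof.
have s0 : 0 <= \sum_i hn (v i) by apply: sumr_ge0 => i _; exact: hnorm_ge0.
rewrite -(ler_pXn2r (n := 2)) ?nnegrE ?hnormm_ge0 // sqr_hnormm.
rewrite [leRHS]expr2 mulr_suml; apply: ler_sum => i _.
rewrite expr2 ler_wpM2l ?hnorm_ge0 // (bigD1 i) //= lerDl.
by apply: sumr_ge0 => j _; exact: hnorm_ge0.
Qed.

(** This lets the projection and contraction results be applied to the [m]-fold sum of [H].
    Completeness is checked coordinatewise. *)
Lemma is_hilbert_ipm : is_hilbert ipm.
Proof.
split.
- move=> a x y z; rewrite /ipm mulr_sumr -big_split /=; apply: eq_bigr => i _.
  exact: ip_linear_l.
- move=> x y; rewrite /ipm (big_morph _ (@conjcD R) (@conjc0 R)).
  by apply: eq_bigr => i _; exact: ipC.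
- by move=> x; rewrite /ipm Re_sum sumr_ge0 // => i _; exact: ip_pos.
- move=> x h; apply/funext => i; apply: (hnorm_eq0 hH).
  apply/eqP; rewrite eq_le hnorm_ge0 andbT; apply: le_trans (hnorm_le_hnormm x i) _.
  by rewrite -hnorm_ipm /hnorm h sqrtr0.
- move=> u hu.
  have /choice [l hl] : forall i, exists l : H, forall e : R, 0 < e ->
      exists N, forall p, (N <= p)%N -> hn (u p i - l) < e.
    move=> i; apply: (ip_complete hH) => e /hu [N hN]; exists N => p q hp hq.
    apply: le_lt_trans (hN p q hp hq); rewrite hnorm_ipm.
    exact: (hnorm_le_hnormm (u p - u q)).
  (* Dividing by [m.+1] makes the sum of the [m] coordinate errors strictly smaller than [e], also
     for [m] equal to zero. *)
  exists l => e e0; have e1 : 0 < e / m.+1%:R by rewrite divr_gt0 ?ltr0Sn.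
  have /choice [N hN] : forall i, exists N, forall p, (N <= p)%N ->
      hn (u p i - l i) < e / m.+1%:R by move=> i; exact: hl.
  exists (\max_i N i)%N => p hp; rewrite hnorm_ipm.
  apply: le_lt_trans (hnormm_le_sum _) _.
  apply: (@le_lt_trans _ _ (\sum_(i < m) e / m.+1%:R)).
    apply: ler_sum => i _; apply: ltW; apply: hN; apply: leq_trans hp.
    exact: leq_bigmax.
  rewrite sumr_const card_ord -[_ *+ m]mulr_natr -mulrA gtr_pMr // mulrC.
  by rewrite ltr_pdivrMr ?ltr0Sn // mul1r ltr_nat.
Qed.

Lemma closed_in_Sm (S : set H) : closed_subspace ip S ->
  closed_subspace ipm [set v | in_Sm S v].
Proof.
move=> hS; split; first by move=> i; exact: subspace0 hS.
  move=> a x y hx hy i; apply: (subspaceD hS); last exact: hy.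
  apply: (subspaceZ _ hS); exact: hx.
move=> x h i; case: (hS) => _ _; apply => e /h [y [hy hxy]]; exists (y i).
split; first exact: hy.
by apply: le_lt_trans hxy; rewrite hnorm_ipm; exact: (hnorm_le_hnormm (x - y)).
Qed.

(* [X (x) I_H] has the same norm as [X].  Peel off the vectors [w k] one at a time:
   subtracting from all of them the projection onto one of them kills it, and by
   Pythagoras the two parts contribute separately, one of them being scalar. *)
Lemma amplified_bound (x : 'I_m -> 'I_m -> R[i]) (K : R) :
  (forall a : 'I_m -> R[i], \sum_i cnorm (\sum_k x i k * a k) ^+ 2
     <= K * \sum_k cnorm (a k) ^+ 2) ->
  forall w : 'I_m -> H, \sum_i hn (\sum_k x i k *: w k) ^+ 2
     <= K * \sum_k hn (w k) ^+ 2.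
Proof.
move=> hx w.
(* Induction on the number [j] of leading vectors that may be nonzero. *)
suff: forall j, (j <= m)%N -> forall w : 'I_m -> H,
    (forall k : 'I_m, (j <= k)%N -> w k = 0) ->
    \sum_i hn (\sum_k x i k *: w k) ^+ 2 <= K * \sum_k hn (w k) ^+ 2.
  by move/(_ m (leqnn m)); apply => k; rewrite leqNgt ltn_ord.
elim=> [_ {}w w0|j IH jm {}w w0].
  rewrite big1 => [|i _]; last first.
    by rewrite big1 ?hnorm0 ?expr0n // => k _; rewrite w0 // scaler0.
  by rewrite big1 ?mulr0 // => k _; rewrite w0 // hnorm0 // expr0n.
pose e := w (Ordinal jm).
have [e0|e0] := EM (e = 0).
  apply: IH (ltnW jm) _ _ => k; rewrite leq_eqVlt => /orP [/eqP jk|]; last exact: w0.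
  by rewrite -e0; congr w; apply/val_inj.
pose a k := ipcoef (ip := ip) (w k) e.
pose w' k := w k - a k *: e.
have ow k : ip (w' k) e = 0 by exact: ipcoef_orth.
have {IH} := IH (ltnW jm) w' => IH.
have {}IH : \sum_i hn (\sum_k x i k *: w' k) ^+ 2 <= K * \sum_k hn (w' k) ^+ 2.
  apply: IH => k; rewrite leq_eqVlt => /orP [/eqP jk|/w0 wk]; rewrite /w'.
    have -> : k = Ordinal jm by apply/val_inj.
    rewrite /a /ipcoef divff ?scale1r ?subrr //.
    by apply/eqP => /(ip_def hH).
  by rewrite /a wk /ipcoef ip0l // mul0r scale0r subr0.
have -> : \sum_k hn (w k) ^+ 2 =
    \sum_k hn (w' k) ^+ 2 + (\sum_k cnorm (a k) ^+ 2) * hn e ^+ 2.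
  rewrite mulr_suml -big_split /=; apply: eq_bigr => k _.
  exact: hnorm_ipcoef.
have -> : \sum_i hn (\sum_k x i k *: w k) ^+ 2 =
    \sum_i hn (\sum_k x i k *: w' k) ^+ 2 +
    (\sum_i cnorm (\sum_k x i k * a k) ^+ 2) * hn e ^+ 2.
  rewrite mulr_suml -big_split /=; apply: eq_bigr => i _.
  rewrite -exprMn -(hnormZ hH) -(pythagoras hH).
    rewrite scaler_suml -big_split /=; congr (hn _ ^+ 2); apply: eq_bigr => k _.
    by rewrite -scalerA -scalerDr subrK.
  rewrite ipZr // ip_suml // [X in _ * X]big1 ?mulr0 // => k _.
  by rewrite ipZl // ow mulr0.
by rewrite mulrDr mulrA lerD // ler_wpM2r ?sqr_ge0.
Qed.

End Amplification.

Section Contraction.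
Context {R : realType} {V : lmodType R[i]} {ip : V -> V -> R[i]}.
Context (hV : is_hilbert ip) {D : set V} (hD : closed_subspace ip D).
Local Notation hn := (hnorm ip).

(** Banach iteration from 0 with ratio one half, carried out inside [D]. *)
Lemma contraction_fixpoint (F : V -> V) : maps_into D F ->
  (forall u v, D u -> D v -> hn (F u - F v) <= hn (u - v) / 2) ->
  exists u, D u /\ F u = u.
Proof.
move=> FD Fc; pose u k := iter k F 0.
have Du k : D (u k) by elim: k => [|k IH] /=; [exact: subspace0 hD | exact: FD].
pose B := hn (u 1%N - u 0%N).
have B0 : 0 <= B by exact: hnorm_ge0.
have step k : hn (u k.+1 - u k) <= B / 2 ^+ k.
  elim: k => [|k IH]; first by rewrite expr0 divr1.
  have /le_trans := Fc (u k.+1) (u k) (Du _) (Du _); apply.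
  by rewrite exprSr invfM mulrA ler_pM2r ?invr_gt0.
(* The geometric bound is weakened to a harmonic one so that [invr_nat_small] applies; only
   convergence of the steps to zero is used below. *)
have {}step k : hn (u k.+1 - u k) <= B / k.+1%:R.
  apply: le_trans (step k) _; rewrite ler_wpM2l // lef_pV2 ?posrE ?exprn_gt0 ?ltr0Sn //.
  by rewrite -natrX ler_nat ltn_expl.
have [e e0|l hl] := @ip_complete _ _ _ hV u.
  have e1 : 0 < e / 4 / (B + 1) by rewrite !divr_gt0 // ltr_wpDl.
  have [N hN] := invr_nat_small e1; exists N => p q hp hq.
  have small r : (N <= r)%N -> hn (u r.+1 - u r) < e / 4.
    move=> hr; apply: le_lt_trans (step r) _.
    have := hN r hr; rewrite ltr_pdivlMr ?ltr_wpDl //; apply: le_lt_trans.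
    by rewrite mulrC ler_wpM2l ?invr_ge0 // lerDl.
  (* By contraction the distance from [u p] to [u q] is at most two small steps plus half of itself,
     so it is below [e] without summing a series. *)
  have := small p hp; have := small q hq.
  have := ler_hnormB hV (u p) (u p.+1) (u q).
  have := ler_hnormB hV (u p.+1) (u q.+1) (u q).
  have := Fc _ _ (Du p) (Du q); rewrite [hn (u p - u p.+1)](hnormBC hV) /=.
  move: (hn (u p - u q)) (hn (F (u p) - F (u q))) => x y; lra.
have Dl : D l.
  case: (hD) => _ _; apply => e /hl [N hN]; exists (u N).
  by split; [exact: Du | rewrite (hnormBC hV); exact: hN].
exists l; split => //; apply/esym/subr0_eq/(hnorm_eq0 hV)/eqP.
rewrite eq_le hnorm_ge0 andbT; apply/ler_addgt0Pr => e e0; rewrite add0r.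
have e2 : 0 < e / 2 by rewrite divr_gt0.
have [N hN] := hl _ e2.
have h1 := hN N (leqnn _); have h2 := hN N.+1 (leqnSn _).
have h3 := Fc _ _ (Du N) Dl; have h4 := ler_hnormB hV l (u N.+1) (F l).
move: h4; rewrite [hn (l - u N.+1)](hnormBC hV) /=; move: h1 h2 h3 => /= h1 h2 h3 h4; lra.
Qed.

(* Solving [L' u = v] amounts to solving [L u = v + (L u - L' u)], a contraction
   once [L] is inverted. *)
Lemma perturb_onto (L L' : V -> V) (K : R) : 0 <= K ->
  linear_on D L -> linear_on D L' -> maps_into D L -> maps_into D L' ->
  (forall u, D u -> hn u <= K * hn (L u)) ->
  (forall u, D u -> K * hn (L u - L' u) <= hn u / 2) ->
  (forall v, D v -> exists u, D u /\ L u = v) ->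
  forall v, D v -> exists u, D u /\ L' u = v.
Proof.
move=> K0 lL lL' DL DL' bL small onto v Dv.
have linB (f : V -> V) : linear_on D f -> forall x y, D x -> D y -> f (x - y) = f x - f y.
  move=> lf x y Dx Dy; rewrite addrC -scaleN1r lf //.
  by rewrite scaleN1r addrC.
(* [T] chooses a preimage under [L] for each vector of [D]; the lower bound on [L] makes it
   Lipschitz there with constant [K]. *)
have /choice [T hT] : forall w, exists u, D w -> D u /\ L u = w.
  move=> w; have [/onto [u hu]|nw] := EM (D w); first by exists u.
  by exists 0.
have Dw u : D u -> D (v + (L u - L' u)).
  by move=> Du; apply: (subspaceD hD) => //; apply: (subspaceB hD); [exact: DL | exact: DL'].
have [|x y Dx Dy|u [Du Fu]] := @contraction_fixpoint (fun u => T (v + (L u - L' u))).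
- by move=> u Du /=; exact: (hT _ (Dw _ Du)).1.
- have [Dx' ex] := hT _ (Dw _ Dx); have [Dy' ey] := hT _ (Dw _ Dy).
  apply: le_trans (bL _ (subspaceB hD Dx' Dy')) _.
  rewrite (linB L) // ex ey opprD addrACA subrr add0r.
  apply: le_trans (small _ (subspaceB hD Dx Dy)).
  suff -> : L x - L' x - (L y - L' y) = L (x - y) - L' (x - y) by [].
  by rewrite (linB L) // (linB L') // !opprD !opprK [LHS]addrACA.
- exists u; split => //; have [_] := hT _ (Dw _ Du).
  by rewrite Fu addrCA -[LHS]addr0 => /addrI/esym/subr0_eq.
Qed.

End Contraction.

(** * The column norm and linear pencils *)

Section ColumnNorm.
Context {R : realType} {d : nat}.

Lemma cnorm_sum (I : Type) (r : seq I) (Q : pred I) (F : I -> R[i]) :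
  cnorm (\sum_(i <- r | Q i) F i) <= \sum_(i <- r | Q i) cnorm (F i).
Proof.
elim/big_ind2: _ => [|x a y b h1 h2|//]; first by rewrite cnorm0.
by apply: le_trans (lerD h1 h2); exact: le_normcD.
Qed.

Section Size.
Context {k : nat}.
Implicit Types (v : 'cV[R[i]]_k) (X : 'I_d -> 'M[R[i]]_k).

Lemma vnorm2_ge0 v : 0 <= vnorm2 v.
Proof. by apply: sumr_ge0 => i _; rewrite sqr_ge0. Qed.

Lemma vnorm2Z a v : vnorm2 (a *: v) = cnorm a ^+ 2 * vnorm2 v.
Proof.
by rewrite /vnorm2 mulr_sumr; apply: eq_bigr => i _; rewrite mxE cnormM exprMn.
Qed.

Lemma cnorm_entry v i : cnorm (v i ord0) ^+ 2 <= vnorm2 v.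
Proof.
rewrite /vnorm2 (bigD1 i) //= lerDl; apply: sumr_ge0 => j _; exact: sqr_ge0.
Qed.

Lemma vnorm2_eq0 v : vnorm2 v = 0 -> v = 0.
Proof.
move=> v0; apply/matrixP => i j; rewrite ord1 mxE; apply: cnorm_eq0.
apply/eqP; rewrite -sqrf_eq0 eq_le sqr_ge0 andbT -v0; exact: cnorm_entry.
Qed.

Lemma vnorm2_0 : vnorm2 (0 : 'cV[R[i]]_k) = 0.
Proof. by rewrite /vnorm2 big1 // => i _; rewrite mxE cnorm0 expr0n. Qed.

Local Notation colset X :=
  [set Num.sqrt (\sum_(j < d) vnorm2 (X j *m v)) | v in [set v | vnorm2 v = 1]].

(** Entries of a unit vector have modulus at most 1, so row sums of moduli give a bound. This makes
    the [sup] in [colnorm] a true supremum whenever the set is nonempty. *)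
Lemma colnorm_has_ubound X : has_ubound (colset X).
Proof.
exists (Num.sqrt (\sum_j \sum_i (\sum_l cnorm (X j i l)) ^+ 2)) => _ [v v1 <-].
rewrite ler_wsqrtr //; apply: ler_sum => j _; apply: ler_sum => i _.
rewrite ler_pXn2r ?nnegrE ?cnorm_ge0 //; last first.
  by apply: sumr_ge0 => l _; exact: cnorm_ge0.
rewrite mxE; apply: le_trans (cnorm_sum _ _ _) _; apply: ler_sum => l _.
rewrite cnormM -[leRHS]mulr1 ler_wpM2l ?cnorm_ge0 //.
by rewrite -(ler_pXn2r (n := 2)) ?nnegrE ?cnorm_ge0 // expr1n -v1 cnorm_entry.
Qed.

Lemma colnorm_ge0 X : 0 <= colnorm X.
Proof.
(* At size zero there is no unit vector, and [sup] of the empty set is 0. *)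
have [|/set0P [_ [v v1 _]]] := eqVneq (colset X) set0.
  by rewrite /colnorm => ->; rewrite sup0.
apply: le_trans (sqrtr_ge0 _) (ub_le_sup (colnorm_has_ubound X) _).
by exists v.
Qed.

Lemma colnorm0 X : (forall j, X j = 0) -> colnorm X = 0.
Proof.
move=> X0; have [|ne] := eqVneq (colset X) set0.
  by rewrite /colnorm => ->; rewrite sup0.
apply/eqP; rewrite eq_le colnorm_ge0 andbT.
apply: ge_sup => [|_ [v _ <-]]; first exact/set0P.
by rewrite big1 ?sqrtr0 // => j _; rewrite X0 mul0mx vnorm2_0.
Qed.

Lemma colnorm_bound X v :
  \sum_(j < d) vnorm2 (X j *m v) <= colnorm X ^+ 2 * vnorm2 v.
Proof.
have [/vnorm2_eq0 ->|v0] := eqVneq (vnorm2 v) 0.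
  by rewrite vnorm2_0 mulr0 big1 // => j _; rewrite mulmx0 vnorm2_0.
have vp : 0 < vnorm2 v by rewrite lt_neqAle eq_sym v0 vnorm2_ge0.
pose a := real_complex R (Num.sqrt (vnorm2 v))^-1.
have a2 : cnorm a ^+ 2 = (vnorm2 v)^-1.
  by rewrite cnorm_real real_normK ?num_real // exprVn sqr_sqrtr // ltW.
have s0 : 0 <= \sum_(j < d) vnorm2 (X j *m (a *: v)).
  by apply: sumr_ge0 => j _; exact: vnorm2_ge0.
have : Num.sqrt (\sum_(j < d) vnorm2 (X j *m (a *: v))) <= colnorm X.
  apply: (ub_le_sup (colnorm_has_ubound X)); exists (a *: v) => //=.
  by rewrite vnorm2Z a2 mulVf.
rewrite -(ler_pXn2r (n := 2)) ?nnegrE ?sqrtr_ge0 ?colnorm_ge0 // sqr_sqrtr //.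
rewrite (eq_bigr (fun j => (vnorm2 v)^-1 * vnorm2 (X j *m v))) => [|j _].
  by rewrite -mulr_sumr mulrC ler_pdivrMr.
by rewrite -scalemxAr vnorm2Z a2.
Qed.

End Size.

Lemma sum_mxtens (V : nmodType) (m n : nat) (F : 'I_(m * n) -> V) :
  \sum_s F s = \sum_i \sum_p F (mxtens_index (i, p)).
Proof.
rewrite pair_big /= (reindex (@mxtens_index m n)) /=; first by apply: eq_bigr => -[].
exists (@mxtens_unindex m n) => x _; [exact: mxtens_indexK | exact: mxtens_unindexK].
Qed.

(** The scalar matrix of the [(p, q)] entries of all blocks is a corner of [X j]: insert [a] in the
    coordinates [(k, q)], apply [X j], and keep only the coordinates [(i, p)]. *)
Lemma colnorm_slice (m n : nat) (X : 'I_d -> 'M[R[i]]_(m * n)) j p q (a : 'I_m -> R[i]) :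
  \sum_i cnorm (\sum_k blk (X j) i k p q * a k) ^+ 2
    <= colnorm X ^+ 2 * \sum_k cnorm (a k) ^+ 2.
Proof.
pose v : 'cV[R[i]]_(m * n) := \col_s
  (if (mxtens_unindex s).2 == q then a (mxtens_unindex s).1 else 0).
have vE k q' : v (mxtens_index (k, q')) ord0 = if q' == q then a k else 0.
  by rewrite mxE mxtens_indexK.
have <- : vnorm2 v = \sum_k cnorm (a k) ^+ 2.
  rewrite /vnorm2 sum_mxtens; apply: eq_bigr => k _.
  rewrite (bigD1 q) //= vE eqxx big1 ?addr0 // => q' /negPf q'q.
  by rewrite vE q'q cnorm0 expr0n.
apply: le_trans (colnorm_bound X v).
apply: (@le_trans _ _ (vnorm2 (X j *m v))); last first.
  by rewrite (bigD1 j) //= lerDl; apply: sumr_ge0 => j' _; exact: vnorm2_ge0.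
rewrite /vnorm2 sum_mxtens; apply: ler_sum => i _.
rewrite (bigD1 p) //= -[leLHS]addr0 lerD //; last first.
  by apply: sumr_ge0 => p' _; exact: sqr_ge0.
suff -> : (X j *m v) (mxtens_index (i, p)) ord0 = \sum_k blk (X j) i k p q * a k by [].
rewrite mxE sum_mxtens; apply: eq_bigr => k _.
rewrite (bigD1 q) //= vE eqxx mxE big1 ?addr0 // => q' /negPf q'q.
by rewrite vE q'q mulr0.
Qed.

End ColumnNorm.

Section Pencil.
Context {R : realType} {H : lmodType R[i]} {ip : H -> H -> R[i]} {d n : nat}.
Context {S : set H} {A : 'I_d -> 'M[R[i]]_n -> H -> H} {b c : 'cV[R[i]]_n -> H}.
Context (hH : is_hilbert ip) (hr : is_realization ip S A b c).
Local Notation hn := (hnorm ip).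

Definition ampA (m : nat) (X : 'I_d -> 'M[R[i]]_(m * n)) (v : 'I_m -> H) : 'I_m -> H :=
  fun i => \sum_(j < d) \sum_(k < m) A j (blk (X j) i k) (v k).

Let hS : closed_subspace ip S. Proof. by case: hr. Qed.

Lemma op_in j G x : S x -> S (A j G x).
Proof. by case: hr => _ h _ _ _; case: (h j G) => h1 _ _; exact: h1. Qed.

Lemma op_lin j G a x y : S x -> S y -> A j G (a *: x + y) = a *: A j G x + A j G y.
Proof. by case: hr => _ h _ _ _; case: (h j G) => _ h1 _; exact: h1. Qed.

Lemma op_mxD j G G' x : S x -> A j (G + G') x = A j G x + A j G' x.
Proof. by case: hr => _ _ h _ _ Sx; have := h j 1 G G' x Sx; rewrite !scale1r. Qed.

Lemma op_mx0 j x : S x -> A j 0 x = 0.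
Proof. by move=> Sx; apply: (addIr (A j 0 x)); rewrite -op_mxD // !add0r. Qed.

Lemma op_mxZ j a G x : S x -> A j (a *: G) x = a *: A j G x.
Proof.
by case: hr => _ _ h _ _ Sx; have := h j a G 0 x Sx; rewrite addr0 op_mx0 // addr0.
Qed.

Lemma op_mxB j G G' x : S x -> A j (G - G') x = A j G x - A j G' x.
Proof. by move=> Sx; rewrite op_mxD // -[- G']scaleN1r op_mxZ // scaleN1r. Qed.

Lemma op_mx_delta j G x : S x ->
  A j G x = \sum_p \sum_q G p q *: A j (delta_mx p q) x.
Proof.
move=> Sx; rewrite {1}(matrix_sum_delta G).
have mD : {morph (fun F : 'M[R[i]]_n => A j F x) : F F' / F + F'}.
  by move=> F F'; exact: op_mxD.
rewrite (big_morph _ mD (op_mx0 j Sx)); apply: eq_bigr => p _.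
rewrite (big_morph _ mD (op_mx0 j Sx)); apply: eq_bigr => q _.
exact: op_mxZ.
Qed.

(* The bound is uniform in the level [m]: the [A j] have finite-dimensional domain,
   so they are completely bounded. *)
Lemma ampA_bound : exists2 K : R, 0 <= K &
  forall m (X : 'I_d -> 'M[R[i]]_(m * n)) v, in_Sm S v ->
    hnormm ip (ampA X v) <= K * colnorm X * hnormm ip v.
Proof.
have /choice [K0 hK0] : forall t : 'I_d * ('I_n * 'I_n), exists K : R,
    0 <= K /\ forall x, S x -> hn (A t.1 (delta_mx t.2.1 t.2.2) x) <= K * hn x.
  move=> [j [p q]] /=; case: hr => _ h _ _ _; case: (h j (delta_mx p q)) => _ _ [K hK].
  exists `|K|; split => // x Sx; apply: le_trans (hK x Sx) _.
  by rewrite ler_wpM2r ?hnorm_ge0 ?ler_norm.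
exists (\sum_t K0 t) => [|m X v Sv]; first by apply: sumr_ge0 => t _; exact: (hK0 t).1.
pose hV := is_hilbert_ipm (m := m) hH.
(* [T t] is the contribution of one matrix unit in one variable: a fixed bounded operator applied to
   each [v k], followed by the amplification of a scalar slice of [X]. *)
pose T (t : 'I_d * ('I_n * 'I_n)) : 'I_m -> H := fun i =>
  \sum_k blk (X t.1) i k t.2.1 t.2.2 *: A t.1 (delta_mx t.2.1 t.2.2) (v k).
have -> : ampA X v = \sum_t T t.
  apply/funext => i; rewrite fct_sumE /ampA /T.
  rewrite -(pair_bigA _ (fun j pq => \sum_k blk (X j) i k pq.1 pq.2 *:
    A j (delta_mx pq.1 pq.2) (v k))) /=; apply: eq_bigr => j _.
  rewrite exchange_big /=; apply: eq_bigr => k _.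
  by rewrite op_mx_delta // pair_bigA.
rewrite -(hnorm_ipm hH); apply: le_trans (ler_hnorm_sum hV _ _ _) _.
rewrite !mulr_suml; apply: ler_sum => t _; rewrite (hnorm_ipm hH).
have [K1 K2] := hK0 t; have c0 := colnorm_ge0 X.
rewrite -(ler_pXn2r (n := 2)) ?nnegrE ?mulr_ge0 ?hnormm_ge0 //.
rewrite sqr_hnormm.
apply: le_trans (amplified_bound hH (colnorm_slice X t.1 t.2.1 t.2.2) _) _.
rewrite !exprMn [K0 t ^+ 2 * _]mulrC -[leRHS]mulrA ler_wpM2l ?sqr_ge0 //.
rewrite sqr_hnormm mulr_sumr; apply: ler_sum => k _.
by rewrite -exprMn ler_pXn2r ?nnegrE ?mulr_ge0 ?hnorm_ge0 // K2.
Qed.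

Section Level.
Context {m : nat}.
Implicit Types (X : 'I_d -> 'M[R[i]]_(m * n)) (v : 'I_m -> H) (Y : 'I_d -> 'M[R[i]]_n).

Lemma ampA_in X v : in_Sm S v -> in_Sm S (ampA X v).
Proof.
move=> Sv i; rewrite /ampA; apply: (subspace_sum _ hS) => j _; apply: (subspace_sum _ hS) => k _.
exact: op_in.
Qed.

Lemma LA_ampA X v : LA A X v = v - ampA X v.
Proof. by []. Qed.

Lemma LA_in X v : in_Sm S v -> in_Sm S (LA A X v).
Proof. by move=> Sv i; apply: (subspaceB hS); [exact: Sv | exact: ampA_in]. Qed.

Lemma LA_lin X a v w : in_Sm S v -> in_Sm S w ->
  LA A X (a *: v + w) = a *: LA A X v + LA A X w.
Proof.
move=> Sv Sw; rewrite !LA_ampA; have -> : ampA X (a *: v + w) = a *: ampA X v + ampA X w.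
  apply/funext => i; change (ampA X (a *: v + w) i = a *: ampA X v i + ampA X w i).
  rewrite /ampA scaler_sumr -big_split /=.
  apply: eq_bigr => j _; rewrite scaler_sumr -big_split /=; apply: eq_bigr => k _.
  exact: op_lin.
by rewrite scalerBr opprD addrACA.
Qed.

Lemma LA_shiftB Y X X' v : in_Sm S v ->
  LA A (shiftY Y X) v - LA A (shiftY Y X') v = ampA (fun j => X' j - X j) v.
Proof.
move=> Sv; rewrite !LA_ampA opprB addrC addrA subrK.
apply/funext => i; change (ampA (shiftY Y X') v i - ampA (shiftY Y X) v i =
  ampA (fun j => X' j - X j) v i).
rewrite /ampA -sumrB; apply: eq_bigr => j _.
rewrite -sumrB; apply: eq_bigr => k _; rewrite -op_mxB //; congr (A j _ (v k)).
by apply/matrixP => p q; rewrite !mxE; ring.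
Qed.

Lemma LA_ampl Y v : in_Sm S v -> LA A (shiftY Y (ampl Y)) v = v.
Proof.
move=> Sv; rewrite LA_ampA; have -> : ampA (shiftY Y (ampl Y)) v = 0; last by rewrite subr0.
apply/funext => i; rewrite /ampA big1 // => j _; rewrite big1 // => k _.
have -> : blk (shiftY Y (ampl Y) j) i k = 0; last exact: op_mx0.
by apply/matrixP => p q; rewrite !mxE subrr.
Qed.

End Level.

End Pencil.

(** * Invertibility of pencils along paths and transfer functions *)

(** Connectedness of the unit interval. The local hypothesis moves [Q] between any two points near
    [t], because at the supremum of the good initial segments [Q] is not known in advance and has to
    be carried over from a nearby point. *)
Lemma unit_interval_induction (R : realType) (Q : R -> Prop) : Q 0 ->
  (forall t, 0 <= t <= 1 -> exists2 del : R, 0 < del & forall s s',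
     0 <= s <= 1 -> 0 <= s' <= 1 -> `|s - t| < del -> `|s' - t| < del -> Q s -> Q s') ->
  Q 1.
Proof.
move=> Q0 loc; pose E := [set t : R | 0 <= t <= 1 /\ forall s, 0 <= s <= t -> Q s].
have E0 : E 0.
  split; first by rewrite lexx ler01.
  by move=> s; rewrite -eq_le => /eqP <-.
have ubE : has_ubound E by exists 1 => t [/andP []].
have le_t0 t : E t -> t <= sup E by move=> Et; exact: ub_le_sup.
have t01 : 0 <= sup E <= 1.
  rewrite le_t0 //=; apply: ge_sup; first by exists 0.
  by move=> t [/andP []].
have [del del0 hdel] := loc _ t01.
have hsE : has_sup E by split => //; exists 0.
have [s0 Es0 hs0] := sup_adherent del0 hsE.
have s0t := le_t0 _ Es0; case: (Es0) => /andP [s00 s01] Qs0.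
have Qnear s : s0 <= s -> s <= 1 -> s <= sup E + del / 2 -> Q s.
  move=> s0s s1 st; apply: (hdel s0) => //; rewrite ?s00 ?s01 ?s1 ?(le_trans s00 s0s) //.
  - by rewrite ltr_norml; apply/andP; split; lra.
  - by rewrite ltr_norml; apply/andP; split; lra.
  - by apply: Qs0; rewrite s00 lexx.
have [le1|gt1] := leP 1 (sup E + del / 2); first exact: Qnear.
suff /le_t0 : E (sup E + del / 2) by lra.
split; first by case/andP: t01 => t0 t1; apply/andP; split; lra.
move=> s /andP [sge sle]; have [ss0|ss0] := leP s s0; first by apply: Qs0; rewrite sge.
by apply: Qnear => //; lra.
Qed.

Section Resolvent.
Context {R : realType} {H : lmodType R[i]} {ip : H -> H -> R[i]} {d n m : nat}.
Context {S : set H} {A : 'I_d -> 'M[R[i]]_n -> H -> H} {b c : 'cV[R[i]]_n -> H}.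
Context (hH : is_hilbert ip) (hr : is_realization ip S A b c).
Context (Y : 'I_d -> 'M[R[i]]_n).
Implicit Types (X : 'I_d -> 'M[R[i]]_(m * n)) (u v w : 'I_m -> H).
Local Notation hm := (hnormm ip).
Local Notation L X := (LA A (shiftY Y X)).

(** Invertibility is split into surjectivity and a lower bound: the lower bound passes to the
    restriction to a smaller subspace, while surjectivity has to be proved again there. *)
Definition pencil_onto X :=
  forall v, in_Sm S v -> exists u, in_Sm S u /\ L X u = v.

Definition pencil_bounded_below (K : R) X := forall v, in_Sm S v -> hm v <= K * hm (L X v).

Let hV := is_hilbert_ipm (m := m) hH.
Let hS : closed_subspace ip S. Proof. by case: hr. Qed.
Let hD := closed_in_Sm (m := m) hH hS.

Lemma pencil_onto_perturb (K : R) X X' : 0 <= K -> pencil_bounded_below K X ->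
  (forall v, in_Sm S v -> K * hm (L X v - L X' v) <= hm v / 2) ->
  pencil_onto X -> pencil_onto X'.
Proof.
move=> K0 bb small onto.
apply: (perturb_onto hV hD K0 (L := L X)) => //.
- by move=> a x y; exact: (LA_lin hr).
- by move=> a x y; exact: (LA_lin hr).
- by move=> x; exact: (LA_in hr).
- by move=> x; exact: (LA_in hr).
- by move=> x Sx; rewrite !(hnorm_ipm hH) bb.
- by move=> x Sx; rewrite !(hnorm_ipm hH) small.
Qed.

(** By the triangle inequality the perturbation absorbs at most half of the norm of [v], which
    doubles the constant. *)
Lemma pencil_bounded_below_perturb (K q : R) X X' : 0 <= K -> q <= 2^-1 ->
  pencil_bounded_below K X ->
  (forall v, in_Sm S v -> K * hm (L X v - L X' v) <= q * hm v) ->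
  pencil_bounded_below (2 * K) X'.
Proof.
move=> K0 q2 bb small v Sv.
have := ler_hnormD hV (L X v - L X' v) (L X' v); rewrite !(hnorm_ipm hH) subrK.
have := bb v Sv; have := small v Sv; have v0 := hnormm_ge0 (ip := ip) v.
move=> h1 h2 /(ler_wpM2l K0); rewrite mulrDr => h3.
have h4 : q * hm v <= 2^-1 * hm v by rewrite ler_wpM2r.
rewrite -mulrA; move: (K * _) (K * _) (K * _) (q * _) h1 h2 h3 h4 => x y z t.
by move=> h1 h2 h3 h4; lra.
Qed.

(** The lower bound gives injectivity, which makes the chosen preimages depend linearly on the data,
    and it bounds the inverse by [K]. *)
Lemma pencil_invertible (K : R) X : pencil_bounded_below K X -> pencil_onto X ->
  in_dom ip S A Y X.
Proof.
move=> bb onto.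
have inj v w : in_Sm S v -> in_Sm S w -> L X v = L X w -> v = w.
  move=> Sv Sw e; apply/subr0_eq/(hnorm_eq0 hV)/eqP.
  have Svw : in_Sm S (v - w) := subspaceB hD Sv Sw.
  have Le : L X (v - w) = 0.
    by rewrite -[v - w]addrC -scaleN1r (LA_lin hr) // e scaleN1r addNr.
  rewrite eq_le hnorm_ge0 andbT (hnorm_ipm hH); apply: le_trans (bb _ Svw) _.
  by rewrite Le -(hnorm_ipm hH) (hnorm0 hV) mulr0.
have /choice [T hT] : forall v, exists u, in_Sm S v -> in_Sm S u /\ L X u = v.
  move=> v; have [/onto [u hu]|nv] := EM (in_Sm S v); first by exists u.
  by exists 0.
exists T; split.
- by move=> v Sv; exact: (hT v Sv).1.
- move=> a v w Sv Sw; have [Tv ev] := hT v Sv; have [Tw ew] := hT w Sw.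
  have Savw : in_Sm S (a *: v + w) by apply: (subspaceD hD) => //; exact: (subspaceZ _ hD).
  have [Tvw evw] := hT _ Savw.
  change (T (a *: v + w) = a *: T v + T w); apply: inj => //.
    by apply: (subspaceD hD) => //; exact: (subspaceZ _ hD).
  by rewrite evw (LA_lin hr) // ev ew.
- by exists K => v Sv; have [Tv {2}<-] := hT v Sv; exact: bb.
- move=> v Sv; have [Tv ev] := hT v Sv; split => //.
  have SLv : in_Sm S (L X v) by exact: (LA_in hr).
  have [TLv eLv] := hT _ SLv; exact: inj.
Qed.

Lemma in_dom_bounded_below X : in_dom ip S A Y X ->
  exists2 K : R, 0 <= K & pencil_bounded_below K X.
Proof.
move=> [T [T1 T2 [K hK] T4]]; exists `|K| => // v Sv.
have SLv : in_Sm S (L X v) by exact: (LA_in hr).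
have [<- _] := T4 v Sv; rewrite (T4 v Sv).1.
rewrite -[in leLHS](T4 v Sv).1; apply: le_trans (hK _ SLv) _.
by rewrite ler_wpM2r ?hnormm_ge0 ?ler_norm.
Qed.

(** [inv_on] is defined by choice; any explicit solution in [S] determines its value, so transfer
    functions can be computed from a single solution. *)
Lemma in_dom_solve X u v : in_dom ip S A Y X -> in_Sm S u -> L X u = v ->
  inv_on ip S (L X) v = u.
Proof.
move=> hd Su <-.
have [_ _ _ h] := @epsilon_spec _ (inhabits id) (fun T => is_inverse_on ip S (L X) T) hd.
exact: (h u Su).1.
Qed.

Lemma pencil_ampl : pencil_bounded_below 1 (ampl Y) /\ pencil_onto (ampl Y).
Proof.
split=> v Sv; first by rewrite mul1r (LA_ampl hr).
by exists v; split => //; exact: (LA_ampl hr).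
Qed.

(** At the centre the pencil is the identity, and the hypothesis on [X] bounds the perturbation by
    one half. *)
Lemma pencil_near_center (K : R) X :
  (forall X' v, in_Sm S v -> hm (ampA (A := A) X' v) <= K * colnorm X' * hm v) ->
  K * colnorm (fun j => X j - ampl Y j) <= 2^-1 ->
  in_dom ip S A Y X /\ pencil_onto X.
Proof.
move=> hK small; have [bb onto] := pencil_ampl.
have dif v : in_Sm S v -> 1 * hm (L (ampl Y) v - L X v) <= 2^-1 * hm v.
  move=> Sv; rewrite mul1r (LA_shiftB hr) //; apply: le_trans (hK _ _ Sv) _.
  by rewrite ler_wpM2r ?hnormm_ge0.
have bb' := pencil_bounded_below_perturb ler01 (lexx _) bb dif.
have onto' : pencil_onto X.
  apply: pencil_onto_perturb ler01 bb _ onto => v Sv.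
  by rewrite [_ / 2]mulrC dif.
by split => //; exact: pencil_invertible bb' onto'.
Qed.

End Resolvent.

Lemma in_dom_path_end (R : realType) (H : lmodType R[i]) (ip : H -> H -> R[i])
    (d n m : nat) (S : set H) (A : 'I_d -> 'M[R[i]]_n -> H -> H)
    (Y : 'I_d -> 'M[R[i]]_n) (X : 'I_d -> 'M[R[i]]_(m * n)) :
  in_dom_path ip S A Y X -> in_dom ip S A Y X.
Proof. by move=> [gam [_ <- gdom _]]; apply: gdom; rewrite ler01 lexx. Qed.

Section Transfer.
Context {R : realType} {H : lmodType R[i]} {ip : H -> H -> R[i]} {d n : nat}.
Context {A : 'I_d -> 'M[R[i]]_n -> H -> H} {b c : 'cV[R[i]]_n -> H}.
Context (hH : is_hilbert ip) (hr : is_realization ip setT A b c).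
Context (Y : 'I_d -> 'M[R[i]]_n).
Local Notation C := (ctrl_space ip A c).
Local Notation O := (obs_space ip setT A b).
Local Notation M := (minimal_subspace ip A b c).
Local Notation P := (orthproj ip M).
Local Notation A0 := (fun j G x => P (A j G x)).
Local Notation b0 := (fun v => P (b v)).
Local Notation c0 := (fun v => P (c v)).

(** Restricting to [C] makes the pencil lemmas available there. [c] stands in for [b], whose values
    may lie outside [C]; only the pencil of this realization is used. *)
Lemma ctrl_realization : is_realization ip C A c c.
Proof.
case: (hr) => _ hA hG _ hbc; split.
- exact: (ctrl_closed hH).
- move=> j G; case: (hA j G) => h1 h2 [K hK]; split.
  + by move=> x; exact: (ctrl_inv hH hr).
  + by move=> a x y _ _; exact: h2.
  + by exists K => x _; exact: hK.
- by move=> j a G G' x _; exact: hG.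
- by move=> v; split; exact: (ctrl_c hH).
- by move=> a v w; have [_ ->] := hbc a v w.
Qed.

Lemma transfer_compression m (X : 'I_d -> 'M[R[i]]_(m * n)) :
  in_dom ip setT A Y X -> in_dom ip M A0 Y X -> pencil_onto (S := C) (A := A) Y X ->
  transfer ip setT A b c Y X = transfer ip M A0 b0 c0 Y X.
Proof.
move=> dA dA0 onto; apply/matrixP => r s; rewrite !mxE.
set i := (mxtens_unindex r).1; set p := (mxtens_unindex r).2.
set k := (mxtens_unindex s).1; set q := (mxtens_unindex s).2.
pose w (i' : 'I_m) := if i' == k then c (delta_mx q ord0) else 0.
have hM := minimal_closed (A := A) (b := b) (c := c) hH.
have [|u [Cu Lu]] := onto w.
  by move=> i'; rewrite /w; case: ifP => _; [exact: (ctrl_c hH) | exact: subspace0 (ctrl_closed hH)].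
change (ip (inv_on ip setT (LA A (shiftY Y X)) w i) (b (delta_mx p ord0)) =
  ip (inv_on ip M (LA A0 (shiftY Y X))
    (fun i' => if i' == k then c0 (delta_mx q ord0) else 0) i) (b0 (delta_mx p ord0))).
(* The same [u] is the solution in the full space, and its projection is the solution for the
   compression. *)
rewrite (in_dom_solve dA _ Lu) // (in_dom_solve (u := fun i' => P (u i')) dA0).
- rewrite (ip_orthprojr hH hM); last exact: (orthproj_in hH).
  rewrite -[in LHS](subrK (P (u i)) (u i)) ipDl //.
  rewrite [X in X + _](ip_eq0C hH) ?add0r //; apply: (perp_unobs_b hH).
  exact: (sub_proj_unobs hH).
- by move=> i'; exact: (orthproj_in hH).
- apply/funext => i'.
  transitivity (P (w i')); last first.
    by rewrite /w; case: ifP => // _; exact: (orthproj0 hH).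
  rewrite -Lu /LA (orthprojB hH hM) (orthproj_sum hH hM); congr (_ - _).
  apply: eq_bigr => j _; rewrite (orthproj_sum hH hM); apply: eq_bigr => l _.
  by rewrite -(proj_A hH hr).
Qed.

(* The path argument: on a path of invertible pencils, surjectivity of the restriction
   to the amplified controllable space is locally constant. *)
Lemma path_onto m (X : 'I_d -> 'M[R[i]]_(m * n)) :
  in_dom_path ip setT A Y X -> pencil_onto (S := C) (A := A) Y X.
Proof.
move=> [gam [g0 g1 gdom gcont]].
have hrC := ctrl_realization.
have [B B0 hB] := ampA_bound hH hr.
have dif s t v : hnormm ip (LA A (shiftY Y (gam s)) v - LA A (shiftY Y (gam t)) v) <=
    B * colnorm (fun j => gam t j - gam s j) * hnormm ip v.
  by rewrite (LA_shiftB hr) //; exact: hB.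
rewrite -g1; apply: (unit_interval_induction (Q := fun t => pencil_onto (S := C) Y (gam t))).
  by rewrite g0; exact: (pencil_ampl hrC Y).2.
move=> t t01; have [K K0 bb] := in_dom_bounded_below hr (gdom t t01).
have KB0 : 0 <= K * B by rewrite mulr_ge0.
(* With this radius [K] times the change of the pencil is at most an eighth of the norm; adding 1
   keeps the denominator positive. *)
have e0 : 0 < (8 * (K * B + 1))^-1 by rewrite invr_gt0 mulr_gt0 // ltr_wpDl.
have [del del0 hdel] := gcont t t01 _ e0; exists del => //.
have difK s v : 0 <= s <= 1 -> `|s - t| < del ->
    K * hnormm ip (LA A (shiftY Y (gam t)) v - LA A (shiftY Y (gam s)) v) <=
    8^-1 * hnormm ip v.
  move=> s01 st; apply: le_trans (ler_wpM2l K0 (dif _ _ _)) _.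
  rewrite mulrA ler_wpM2r ?hnormm_ge0 // mulrA.
  apply: le_trans (ler_wpM2l KB0 (ltW (hdel s s01 st))) _.
  rewrite invfM mulrCA ger_pMr ?invr_gt0 // ler_pdivrMr ?ltr_wpDl // mul1r.
  by rewrite lerDl.
move=> s s' s01 s'01 st s't.
(* The lower bound on the whole sum of copies of [H] restricts to the sum of copies of [C]. *)
have bbC : pencil_bounded_below (ip := ip) (S := C) (A := A) Y K (gam t).
  by move=> v _; exact: bb.
have bbs : pencil_bounded_below (ip := ip) (S := C) (A := A) Y (2 * K) (gam s).
  apply: (pencil_bounded_below_perturb hH K0 _ bbC (q := 8^-1)); first by lra.
  by move=> v _; exact: difK.
apply: (pencil_onto_perturb hH hrC _ bbs) => [|v Cv]; first by rewrite mulr_ge0.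
(* Passing from [s] to [s'] through [t] costs two eighths in units of [K]; the doubled constant
   [2 * K] at [s] turns this into exactly the half allowed by the contraction. *)
have h1 := difK s v s01 st; have h2 := difK s' v s'01 s't.
have hV := is_hilbert_ipm (m := m) hH.
have := ler_hnormB hV (LA A (shiftY Y (gam s)) v) (LA A (shiftY Y (gam t)) v)
  (LA A (shiftY Y (gam s')) v).
rewrite [X in _ <= X + _](hnormBC hV) !(hnorm_ipm hH) => /(ler_wpM2l K0).
rewrite mulrDr -[2 * K * _]mulrA; move: (K * _) (K * _) (K * _) h1 h2 => x y z h1 h2 h3; lra.
Qed.

Lemma gen_set_center (r : R) : 0 < r -> gen_set Y r (existT _ n Y).
Proof.
move=> r0.
(* The level is 1; since [1 * n] and [n] are not convertible, [Y] is transported along [mul1n]. *)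
exists 1%N, (fun j => castmx (esym (mul1n n), esym (mul1n n)) (Y j)); split.
  have cast k (f : n = k) : existT (fun k => 'I_d -> 'M[R[i]]_k) n Y =
      existT _ k (fun j => castmx (f, f) (Y j)).
    by case: k / f; congr existT; apply/funext => j; rewrite castmx_id.
  exact: (cast _ (esym (mul1n n))).
by rewrite colnorm0 // => j; rewrite tens_scalar_mx scale1r subrr.
Qed.


End Transfer.

Theorem mainTheorem3 (R : realType) (H : lmodType R[i]) (ip : H -> H -> R[i])
    (d n : nat) (Y : 'I_d -> 'M[R[i]]_n)
    (A : 'I_d -> 'M[R[i]]_n -> H -> H) (b c : 'cV[R[i]]_n -> H) :
  is_hilbert ip ->
  is_realization ip setT A b c ->
  let M := minimal_subspace ip A b c in
  let Q0 := orthproj ip M in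
  let A0 := fun j G x => Q0 (A j G x) in
  let b0 := fun v => Q0 (b v) in
  let c0 := fun v => Q0 (c v) in
  [/\ minimal_realization ip M A0 b0 c0,
      analytically_equiv ip setT A b c M A0 b0 c0 Y &
      forall (m : nat) (X : 'I_d -> 'M[R[i]]_(m * n)),
        in_dom_path ip setT A Y X -> in_dom_path ip M A0 Y X ->
        transfer ip setT A b c Y X = transfer ip M A0 b0 c0 Y X].
Proof.
move=> hH hr M Q0 A0 b0 c0; split; first exact: compression_minimal.
  have hrM : is_realization ip M A0 b0 c0 by exact: compression_realization.
  have hrC := ctrl_realization hH hr.
  have [B1 B1p hB1] := ampA_bound hH hr; have [B2 B2p hB2] := ampA_bound hH hrM.
  have [B3 B3p hB3] := ampA_bound hH hrC.
  (* One constant dominates the bounds for [A] on [H], for the compression on [M] and for [A] on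
     [C]. The radius [(2 * B)^-1] then meets the threshold of [pencil_near_center] for all three, at
     every level [m]. *)
  pose B := B1 + B2 + B3 + 1.
  have B0 : 0 < B by rewrite /B; lra.
  have r0 : 0 < (2 * B)^-1 by rewrite invr_gt0 mulr_gt0.
  exists (gen_set Y (2 * B)^-1); split.
  - move=> p Up; exists [:: existT (fun k => ('I_d -> 'M[R[i]]_k) * R)%type n (Y, (2 * B)^-1)].
    by split=> [|q []].
  - exact: gen_set_center.
  - move=> _ [m [X [-> hX]]]; exists m, X.
    have small B' : 0 <= B' -> B' <= B -> B' * colnorm (fun j => X j - ampl Y j) <= 2^-1.
      move=> B'0 B'B; apply: le_trans (ler_wpM2l B'0 (ltW hX)) _.
      by rewrite invfM mulrCA ger_pMr ?invr_gt0 // ler_pdivrMr // mul1r.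
    have [dA _] := pencil_near_center hH hr (hB1 m) (small _ B1p ltac:(rewrite /B; lra)).
    have [dM _] := pencil_near_center hH hrM (hB2 m) (small _ B2p ltac:(rewrite /B; lra)).
    have [_ oC] := pencil_near_center hH hrC (hB3 m) (small _ B3p ltac:(rewrite /B; lra)).
    by split => //; exact: transfer_compression.
move=> m X pA pM; apply: (transfer_compression hH hr).
- exact: in_dom_path_end pA.
- exact: in_dom_path_end pM.
- exact: (path_onto hH hr).
Qed.
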